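(* Let $\mathcal F$ be a complex Hilbert space and let $\varphi:\mathbb R\to B(\mathcal F)$ be strongly continuous. Then $\varphi$ is reflection positive (for $(\mathbb R,\mathbb R_+,-\mathrm{id}_{\mathbb R})$) if and only if there exists a finite Borel measure $Q$ on $[0,\infty)$ with values in the cone $\mathrm{Herm}(\mathcal F)_+$ of positive bounded hermitian operators such that $$\varphi(x)=\int_0^\infty e^{-\lambda|x|}\,dQ(\lambda)\qquad\text{for all } x\in\mathbb R.$$
   Context: Scalar products are linear in the second argument. A kernel $K:X\times X\to B(\mathcal F)$ is positive definite if for all finite families $x_j\in X$, $v_j\in\mathcal F$ one has $\sum_{j,k}\langle v_j,K(x_j,x_k)v_k\rangle\ge0$. A function $\varphi:\mathbb R\to B(\mathcal F)$ is called reflection positive (with respect to the symmetric semigroup $(\mathbb R,\mathbb R_+,-\mathrm{id}_{\mathbb R})$, $\mathbb R_+=(0,\infty)$) if (RP1) the kernel $(x,y)\mapsto\varphi(x-y)$ on $\mathbb R$ is positive definite and $\varphi(-x)=\varphi(x)$ for all $x\in\mathbb R$, and (RP2) the kernel $(s,t)\mapsto\varphi(s+t)$ on $\mathbb R_+$ is positive definite. A finite $\mathrm{Herm}(\mathcal F)_+$-valued Borel measure $Q$ is a map from Borel sets to $\mathrm{Herm}(\mathcal F)_+$ that is countably additive in the weak operator topology; the integral is understood in the weak sense. *)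

(* Defs.v *)
From HB Require Import structures.
From mathcomp Require Import all_boot all_order all_algebra.
From mathcomp Require Import sesquilinear complex.
From mathcomp Require Import all_classical all_reals all_analysis.

Set Implicit Arguments.
Unset Strict Implicit.
Unset Printing Implicit Defensive.

Import Order.TTheory GRing.Theory Num.Theory.
Import numFieldNormedType.Exports.

Local Open Scope complex_scope.
Local Open Scope classical_set_scope.
Local Open Scope ring_scope.

(* A complex Hilbert space is a complete normed module over R[i] together with
   a positive definite hermitian form inducing its norm. *)
Definition hilbert_dot (R : realType) (F : completeNormedModType R[i])
    (dot : {dot F for Num.conj}) : Prop :=
  forall v : F, `|v| ^+ 2 = dot v v.

(* {dot _ for _} is linear in its first argument, so the arguments are swapped
   to get a scalar product that is linear in the second one. *)
Definition sprod (R : realType) (F : completeNormedModType R[i])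
    (dot : {dot F for Num.conj}) (v w : F) : R[i] := dot w v.

Record bounded_operator (R : realType) (F : completeNormedModType R[i]) :=
  BoundedOperator {
    bounded_operator_fun :> {linear F -> F} ;
    bounded_operatorP : exists M : R, forall v : F,
      `|bounded_operator_fun v| <= M%:C * `|v| }.

Section OperatorNotions.
Variables (R : realType) (F : completeNormedModType R[i]).
Variable dot : {dot F for Num.conj}.

Local Notation sp := (sprod dot).
Local Notation BF := (bounded_operator F).

Definition strongly_continuous (phi : R -> BF) : Prop :=
  forall v : F, continuous (fun x : R => phi x v).

Definition positive_definite (T : Type) (X : set T) (K : T -> T -> BF) : Prop :=
  forall (n : nat) (x : 'I_n -> T) (v : 'I_n -> F), (forall j, X (x j)) ->
    0 <= \sum_(j < n) \sum_(k < n) sp (v j) (K (x j) (x k) (v k)).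

Definition reflection_positive (phi : R -> BF) : Prop :=
  [/\ positive_definite [set: R] (fun x y => phi (x - y)),
      (forall x, phi (- x) = phi x) &
      positive_definite [set s : R | 0 < s] (fun s t => phi (s + t))].

Definition hermitian_operator (A : BF) : Prop :=
  forall v w : F, sp (A v) w = sp v (A w).

Definition positive_hermitian (A : BF) : Prop :=
  hermitian_operator A /\ forall v : F, 0 <= sp v (A v).

(* Only the values of Q on Borel subsets of D are constrained: Q stands for a
   measure on D. *)
Definition hermitian_measure (D : set R) (Q : set R -> BF) : Prop :=
  (forall A : set R, measurable A -> A `<=` D -> positive_hermitian (Q A)) /\
  (forall A : nat -> set R, (forall n, measurable (A n)) ->
     (forall n, A n `<=` D) -> trivIset [set: nat] A -> forall v w : F,
     (fun n : nat => \sum_(i < n) sp v (Q (A i) w) : R[i]^o) @ \oo -->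
       (sp v (Q (\bigcup_n A n) w) : R[i]^o)).

(* The integral of a real function against a complex measure nu on D is
   computed from any decomposition of nu as a combination of four finite
   positive measures with coefficients 1, i, -1, -i; its value does not depend
   on the decomposition. *)
Definition complex_measure_integral (D : set R) (nu : set R -> R[i])
    (f : R -> R) (c : R[i]) : Prop :=
  exists mu : 'I_4 -> {finite_measure set R -> \bar R},
    [/\ (forall A : set R, measurable A -> A `<=` D ->
           nu A = \sum_(k < 4) 'i%C ^+ k * (fine (mu k A))%:C),
        (forall k, (mu k).-integrable D (EFin \o f)) &
        c = \sum_(k < 4) 'i%C ^+ k * (\int[mu k]_(x in D) f x)%:C].

Definition weak_integral (D : set R) (Q : set R -> BF) (f : R -> R)
    (T : BF) : Prop :=
  forall v w : F,
    complex_measure_integral D (fun A => sp v (Q A w)) f (sp v (T w)).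

End OperatorNotions.

(* Main.v *)
Require Import Defs.
From HB Require Import structures.
From mathcomp Require Import all_boot all_order all_algebra.
From mathcomp Require Import sesquilinear complex.
From mathcomp Require Import all_classical all_reals all_analysis.
From mathcomp Require Import measurable_realfun.
From mathcomp Require Import ring lra zify.

(** If [phi] is reflection positive, each [g s = <v, phi s v>] is continuous,
bounded by [g 0] (RP1) and positive definite on the semigroup of positive reals
(RP2). For [h > 0] the functional sending [X^n] to [g (n h)] is nonnegative on
[P^2] and [X P^2]; since [g] is bounded it is also nonnegative on
[(1 - X) P^2], hence on the Bernstein polynomials, hence on every polynomial
that is nonnegative on [0, 1]. The infimum of its values on the polynomials in
[y = exp (- x)] that dominate the indicator of [x <= t] is a distribution
function in [t], whose Stieltjes measure has Laplace transform [g (k h)] at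
[k >= 1]. A finite measure on [0, oo) is determined by its Laplace transform at
the positive integers, because the polynomials [1 - (1 - y^n)^N] in [y], with
[N ~ n exp (n t)], converge to that indicator; so the measures obtained for
[h = 1 / n] are dilations of a single one, [mu_v], and [mu_v] has Laplace
transform [g]. The same uniqueness makes the polarisation of [v => mu_v A]
sesquilinear, and Riesz representation turns it into the operator [Q A].

Conversely, [<v_j, phi (x_j - x_k) v_k>] is a limit of Riemann sums
[exp (- t |x_j - x_k|) <v_j, Q I v_k>] over small intervals [I], and
[exp (- t |x - y|) = exp (- t x) exp (- t y) min (exp (2 t x)) (exp (2 t y))]
is a positive kernel. *)

Set Implicit Arguments.
Unset Strict Implicit.
Unset Printing Implicit Defensive.

Import Order.TTheory GRing.Theory Num.Theory.
Import numFieldNormedType.Exports.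

Local Open Scope complex_scope.
Local Open Scope classical_set_scope.
Local Open Scope ring_scope.

(** * Moment functionals on polynomials *)

Section MomentFunctional.
Variable R : realType.
Implicit Types (a : nat -> R) (P : {poly R}).

Definition moment a P : R := \sum_(i < size P) P`_i * a i.

Lemma momentE a P n : (size P <= n)%N -> moment a P = \sum_(i < n) P`_i * a i.
Proof.
move=> Pn; rewrite /moment (big_ord_widen _ (fun i => P`_i * a i) Pn) big_mkcond /=.
by apply: eq_bigr => i _; case: ltnP => // /(nth_default 0) ->; rewrite mul0r.
Qed.

Fact moment_is_linear a : linear_for *%R (moment a).
Proof.
move=> c P Q; pose n := maxn (size (P : {poly R})) (size (Q : {poly R})).
have Pn : (size (P : {poly R}) <= n)%N by rewrite leq_maxl.
have Qn : (size (Q : {poly R}) <= n)%N by rewrite leq_maxr.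
have PQn : (size (c *: (P : {poly R}) + Q)%R <= n)%N.
  by rewrite (leq_trans (size_polyD _ _))// geq_max Qn (leq_trans (size_scale_leq _ _)).
rewrite (momentE a Pn) (momentE a Qn) (momentE a PQn) mulr_sumr -big_split/=.
by apply: eq_bigr => i _; rewrite coefD coefZ mulrDl mulrA.
Qed.

HB.instance Definition _ a :=
  GRing.isLinear.Build R {poly R} R *%R (moment a) (moment_is_linear a).

Lemma momentXn a n : moment a 'X^n = a n.
Proof.
rewrite (@momentE _ _ n.+1) ?size_polyXn// big_ord_recr/= coefXn eqxx mul1r big1 ?add0r// => i _.
by rewrite coefXn ltn_eqF ?mul0r.
Qed.

Lemma moment1 a : moment a 1 = a 0%N.
Proof. by rewrite -(momentXn a 0) expr0. Qed.

Lemma moment_shift a P n : moment a ('X^n * P) = moment (fun k => a (n + k)%N) P.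
Proof.
rewrite -{1}[P]coefK poly_def mulr_sumr linear_sum/=; apply: eq_bigr => i _.
by rewrite -scalerAr linearZ/= -exprD momentXn.
Qed.

Lemma moment_sqr a P : moment a (P ^+ 2) =
  \sum_(i < size P) \sum_(j < size P) P`_i * P`_j * a (i + j)%N.
Proof.
rewrite expr2 -{1 2}[P]coefK poly_def mulr_suml linear_sum/=; apply: eq_bigr => i _.
rewrite mulr_sumr linear_sum/=; apply: eq_bigr => j _.
by rewrite -scalerAr -scalerAl -exprD !linearZ/= momentXn; ring.
Qed.

(** * Positivity on the Bernstein basis from positivity on squares *)

Section Hausdorff.
Variables (a : nat -> R) (C : R).
Hypothesis aC : forall n, `|a n| <= C.
Hypothesis sqr_ge0 : forall P, 0 <= moment a (P ^+ 2).
Hypothesis Xsqr_ge0 : forall P, 0 <= moment a ('X * P ^+ 2).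

(** An even power of ['X] is absorbed into the square, so only the parity of [n] matters. *)
Lemma moment_Xnsqr_ge0 n P : 0 <= moment a ('X^n * P ^+ 2).
Proof.
rewrite -(odd_double_half n); case: (odd n); rewrite /= ?add1n ?add0n.
  by rewrite exprS -mul2n mulnC exprM -mulrA -exprMn Xsqr_ge0.
by rewrite -mul2n mulnC exprM -exprMn sqr_ge0.
Qed.

(* [n => moment a ('X^n * P ^+ 2)] is convex and bounded, hence nonincreasing. *)
Lemma moment_1subXsqr_ge0 P : 0 <= moment a ((1 - 'X) * P ^+ 2).
Proof.
pose b n := moment a ('X^n * P ^+ 2).
have b_cvx n : b n.+1 - b n <= b n.+2 - b n.+1.
  (* The second difference of [b] at [n] is the functional applied to
     ['X^n * ((1 - 'X) * P) ^+ 2]. *)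
  have := moment_Xnsqr_ge0 n ((1 - 'X) * P).
  suff -> : 'X^n * ((1 - 'X) * P) ^+ 2 = 'X^n * P ^+ 2 - 'X^(n.+1) * P ^+ 2
      - ('X^(n.+1) * P ^+ 2 - 'X^(n.+2) * P ^+ 2).
    by rewrite !linearB/= -/(b n) -/(b n.+1) -/(b n.+2); lra.
  rewrite !exprS; move: ('X^n) => Y; ring.
have b_lin n : b 0%N + (b 1%N - b 0%N) *+ n <= b n.
  have bS k : b 1%N - b 0%N <= b k.+1 - b k.
    by elim: k => // k /le_trans; apply.
  elim: n => [|n IH]; first by rewrite mulr0n addr0.
  by rewrite mulrS; have := bS n; lra.
(* A bound on [b] uniform in [n]; with a positive slope, the linear minorant [b_lin] would exceed
   it. *)
pose M := \sum_(i < size (P ^+ 2)) `|(P ^+ 2)`_i| * C.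
have bM n : b n <= M.
  rewrite /b moment_shift /moment; apply: ler_sum => i _.
  by rewrite (le_trans (ler_norm _))// normrM ler_wpM2l.
rewrite mulrBl mul1r linearB/=.
have -> : moment a (P ^+ 2) = b 0%N by rewrite /b expr0 mul1r.
have -> : moment a ('X * P ^+ 2) = b 1%N by rewrite /b expr1.
rewrite leNgt; apply/negP => b10.
have d0 : 0 < b 1%N - b 0%N by lra.
have [n Mn] : exists n, (M - b 0%N) / (b 1%N - b 0%N) < n%:R.
  by exists (Num.truncn ((M - b 0%N) / (b 1%N - b 0%N))).+1; rewrite truncnS_gt.
rewrite ltr_pdivrMr// in Mn.
by have := b_lin n; have := bM n; rewrite -[_ *+ n]mulr_natl; lra.
Qed.

(** Even powers of both factors go into [Q ^+ 2], which leaves the factors [1], ['X], [1 - 'X] and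
    ['X * (1 - 'X)]. *)
Lemma moment_Bernstein_ge0 m n : 0 <= moment a ('X^m * (1 - 'X) ^+ n).
Proof.
pose Q : {poly R} := 'X^(m./2) * (1 - 'X) ^+ n./2.
have -> : 'X^m * (1 - 'X) ^+ n = 'X ^+ odd m * (1 - 'X) ^+ odd n * Q ^+ 2 :> {poly R}.
  rewrite /Q -{1}(odd_double_half m) -{1}(odd_double_half n) !exprD exprMn -!exprM !muln2.
  move: ('X^_ : {poly R}) ((1 - 'X) ^+ _./2.*2) ; move=> *; ring.
case: (odd m); case: (odd n); rewrite /= ?expr0 ?expr1 ?mul1r ?mulr1.
(* The mixed factor is multiplied by [(1 - 'X) + 'X = 1], which reduces it to the two single
   factors. *)
- have -> : 'X * (1 - 'X) * Q ^+ 2 = 'X * ((1 - 'X) * Q) ^+ 2 + (1 - 'X) * ('X * Q) ^+ 2.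
    by ring.
  by rewrite linearD/= addr_ge0 ?moment_1subXsqr_ge0.
- exact: Xsqr_ge0.
- exact: moment_1subXsqr_ge0.
- exact: sqr_ge0.
Qed.

End Hausdorff.
End MomentFunctional.

(** * Bernstein expansions and nonnegative polynomials on the unit interval *)

Section Bernstein.
Variable R : realType.

(** Induction on [j]: the ratio gains the factor [(k - j) / (N - j)], which for [j <= k] is within
    [j / N] of [k / N]. All factors lie in the unit interval, so the errors only add up. *)
Lemma bin_ratio_bound (N k j : nat) : (k <= N)%N -> (j <= N)%N -> (0 < N)%N ->
  `|'C(k, j)%:R / 'C(N, j)%:R - (k%:R / N%:R) ^+ j| <= (j ^ 2)%:R / N%:R :> R.
Proof.
move=> kN jN N0; have N0' : 0 < N%:R :> R by rewrite ltr0n.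
have kN1 : k%:R / N%:R <= 1 :> R by rewrite ler_pdivrMr// mul1r ler_nat.
have kN0 : 0 <= k%:R / N%:R :> R by rewrite divr_ge0.
elim: j jN => [|j IH] jN.
  by rewrite !bin0 expr0 divr1 subrr normr0 mul0r.
have {}IH := IH (ltnW jN).
set q := 'C(k, j)%:R / 'C(N, j)%:R : R in IH.
have CN0 : 0 < 'C(N, j)%:R :> R by rewrite ltr0n bin_gt0 ltnW.
have q0 : 0 <= q by rewrite divr_ge0.
have q1 : q <= 1 by rewrite ler_pdivrMr// mul1r ler_nat leq_bin2l.
have Nj0 : 0 < (N - j)%:R :> R by rewrite ltr0n subn_gt0.
have j0 : j.+1%:R != 0 :> R by rewrite pnatr_eq0.
have -> : 'C(k, j.+1)%:R / 'C(N, j.+1)%:R = q * ((k - j)%:R / (N - j)%:R) :> R.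
  have binE n : 'C(n, j.+1)%:R = (n - j)%:R * 'C(n, j)%:R / j.+1%:R :> R.
    by rewrite -natrM -mul_bin_left natrM mulrC mulKf.
  rewrite !binE /q; field.
  by rewrite !gt_eqF// ltr0n.
have step : `|q * ((k - j)%:R / (N - j)%:R) - q * (k%:R / N%:R)| <= j%:R / N%:R.
  rewrite -mulrBr normrM (ger0_norm q0).
  have [kj|jk] := ltnP k j.
    by rewrite /q bin_small// mul0r mul0r divr_ge0.
  rewrite -[leRHS]mul1r ler_pM// distrC ger0_norm.
    rewrite !natrB// ?(ltnW jN)//.
    have jNR : j%:R < N%:R :> R by rewrite ltr_nat.
    have jkR : j%:R <= k%:R :> R by rewrite ler_nat.
    have kNR : k%:R <= N%:R :> R by rewrite ler_nat.
    have -> : k%:R / N%:R - (k%:R - j%:R) / (N%:R - j%:R) =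
        j%:R / N%:R * ((N%:R - k%:R) / (N%:R - j%:R)) :> R.
      by field; rewrite !gt_eqF// subr_gt0.
    by rewrite ler_piMr ?divr_ge0// ler_pdivrMr ?subr_gt0// mul1r lerD2l lerN2.
  rewrite subr_ge0 ler_pdivlMr// mulrAC ler_pdivrMr// -!natrM ler_nat.
  by rewrite mulnBr mulnBl leq_sub2l// mulnC leq_mul2l kN orbT.
rewrite exprSr.
have -> : q * ((k - j)%:R / (N - j)%:R) - (k%:R / N%:R) ^+ j * (k%:R / N%:R) =
  (q * ((k - j)%:R / (N - j)%:R) - q * (k%:R / N%:R)) +
  (q - (k%:R / N%:R) ^+ j) * (k%:R / N%:R) by ring.
rewrite (le_trans (ler_normD _ _))// normrM (ger0_norm kN0).
have : `|q - (k%:R / N%:R) ^+ j| * (k%:R / N%:R) <= (j ^ 2)%:R / N%:R.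
  by rewrite -[leRHS]mulr1 ler_pM.
move=> /(lerD step)/le_trans; apply.
rewrite -mulrDl ler_pM2r ?invr_gt0// -natrD ler_nat.
lia.
Qed.

(** Multiply ['X^j] by [((1 - 'X) + 'X) ^+ (N - j)], expand, and rewrite ['C(N - j, i)] as
    ['C(i + j, j) * 'C(N, i + j) / 'C(N, j)]. *)
Lemma Bernstein_expand (N j : nat) : (j <= N)%N ->
  'X^j = \sum_(k < N.+1) ('C(k, j)%:R / 'C(N, j)%:R * 'C(N, k)%:R) *:
     ('X^k * (1 - 'X) ^+ (N - k)) :> {poly R}.
Proof.
move=> jN.
rewrite -(big_mkord xpredT (fun k => ('C(k, j)%:R / 'C(N, j)%:R * 'C(N, k)%:R) *:
     ('X^k * (1 - 'X) ^+ (N - k)) : {poly R})).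
rewrite (@big_cat_nat _ _ _ j)//=; last by rewrite leqW.
rewrite [X in _ = X + _]big1_seq ?add0r; last first.
  move=> k /andP[_]; rewrite mem_index_iota => /andP[_ kj].
  by rewrite bin_small// !mul0r scale0r.
rewrite -[X in \sum_(X <= _ < _) _]add0n big_addn subSn// big_mkord.
rewrite -[LHS]mulr1 -[1](expr1n _ (N - j)) -{1}[1](subrK 'X) exprDn mulr_sumr.
apply: eq_bigr => i _.
have iN : (i <= N - j)%N by rewrite -ltnS.
have CN0 : 'C(N, j)%:R != 0 :> R by rewrite pnatr_eq0 -lt0n bin_gt0.
have -> : 'C(i + j, j)%:R / 'C(N, j)%:R * 'C(N, i + j)%:R = 'C(N - j, i)%:R :> R.
  apply: (mulIf CN0); rewrite mulrAC divfK// -!natrM; congr _%:R.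
  have iN2 : (i + j <= N)%N by lia.
  apply/eqP; rewrite -(eqn_pmul2r (fact_gt0 j)) -(eqn_pmul2r (fact_gt0 i)).
  rewrite -(eqn_pmul2r (fact_gt0 (N - j - i))); apply/eqP.
  transitivity N`!.
    rewrite -(bin_fact iN2) -(bin_fact (leq_addl i j)) addnK.
    by rewrite [(i + j)%N]addnC subnDA; lia.
  by rewrite -(bin_fact jN) -(bin_fact iN); lia.
rewrite -scaler_nat -scalerAr; congr (_ *: _).
by rewrite [(i + j)%N]addnC exprD subnDA expr1n -!mulrA; congr (_ * _); rewrite mulrC.
Qed.

(** The Bernstein expansion of degree [N] writes [moment a P] as a sum with nonnegative weights
    [w k], of total [a 0], of numbers within [E / N] of [P.[k / N] >= 0]. Hence
    [moment a P >= - E * a 0 / N] for all large [N]. *)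
Lemma moment_ge0 (a : nat -> R) (P : {poly R}) :
  (forall m n, 0 <= moment a ('X^m * (1 - 'X) ^+ n)) ->
  (forall x, 0 <= x <= 1 -> 0 <= P.[x]) -> 0 <= moment a P.
Proof.
move=> apos Ppos; pose d := size P.
pose E := \sum_(j < d) `|P`_j| * (j ^ 2)%:R.
have a0 : 0 <= a 0%N by have := apos 0%N 0%N; rewrite !expr0 mulr1 moment1.
suff main N : (d < N)%N -> - (E * a 0%N) / N%:R <= moment a P.
  rewrite leNgt; apply/negP => mP.
  pose N := (maxn d (Num.truncn (E * a 0%N / - moment a P))).+1.
  have := main N; rewrite ltnS leq_maxl => /(_ isT).
  have N1 : E * a 0%N / - moment a P < N%:R.
    by rewrite (lt_le_trans (truncnS_gt _))// ler_nat ltnS leq_maxr.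
  rewrite ltr_pdivrMr ?oppr_gt0// in N1.
  by rewrite ler_pdivrMr ?ltr0n//; lra.
move=> dN; have N0 : (0 < N)%N by case: N dN.
pose w k := 'C(N, k)%:R * moment a ('X^k * (1 - 'X) ^+ (N - k)).
have w0 k : 0 <= w k by rewrite mulr_ge0.
have aE j : (j <= N)%N -> a j = \sum_(k < N.+1) w k * ('C(k, j)%:R / 'C(N, j)%:R).
  move=> jN; rewrite -(momentXn a) (Bernstein_expand jN) linear_sum/=.
  by apply: eq_bigr => k _; rewrite linearZ/= /w; ring.
have w1 : \sum_(k < N.+1) w k = a 0%N.
  by rewrite aE//; apply: eq_bigr => k _; rewrite !bin0 divr1 mulr1.
have -> : moment a P = \sum_(k < N.+1) w k * \sum_(j < d) P`_j * ('C(k, j)%:R / 'C(N, j)%:R).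
  under eq_bigr do rewrite mulr_sumr.
  rewrite exchange_big /moment; apply: eq_bigr => j _ /=.
  rewrite aE ?mulr_sumr; last by rewrite ltnW// (ltn_trans _ dN).
  by apply: eq_bigr => k _; ring.
rewrite -w1 mulr_sumr -sumrN mulr_suml; apply: ler_sum => k _.
have -> : - (E * w k) / N%:R = w k * - (E / N%:R) by ring.
apply: ler_wpM2l => //.
have kN : (k <= N)%N by rewrite -ltnS.
have Pk : 0 <= P.[k%:R / N%:R].
  by rewrite Ppos// divr_ge0//= ler_pdivrMr ?ltr0n// mul1r ler_nat.
suff : - (E / N%:R) <= \sum_(j < d) P`_j * ('C(k, j)%:R / 'C(N, j)%:R) - P.[k%:R / N%:R].
  by lra.
rewrite horner_coef -/d -sumrB lerNl -sumrN /E mulr_suml; apply: ler_sum => j _.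
rewrite -mulrBr (le_trans (ler_norm _))// normrN normrM -mulrA ler_wpM2l//.
by rewrite bin_ratio_bound// ltnW// (ltn_trans _ dN).
Qed.

End Bernstein.

(** * Polynomial approximation of indicator functions *)

Section CutOff.
Variable R : realType.
Implicit Types (t y d : R) (n : nat).

(* With [y = expR (- x)], [m = n.+1] and [N ~ m * expR (t * m)], the polynomial
   1 - (1 - y ^ m) ^ N ~ 1 - expR (- m * expR (m * (t - x)))
   drops from 1 to 0 when [x] crosses [t]. *)
Definition cutoff t n : {poly R} :=
  1 - (1 - 'X^(n.+1)) ^+ (Num.truncn (n.+1%:R * expR (t * n.+1%:R))).+1.

Lemma cutoffE t n y : (cutoff t n).[y] =
  1 - (1 - y ^+ n.+1) ^+ (Num.truncn (n.+1%:R * expR (t * n.+1%:R))).+1.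
Proof. by rewrite /cutoff !hornerE. Qed.

Lemma cutoff_coef0 t n : (cutoff t n)`_0 = 0.
Proof. by rewrite -horner_coef0 cutoffE expr0n/= subr0 expr1n subrr. Qed.

Lemma cutoff_itv t n y : 0 <= y <= 1 -> 0 <= (cutoff t n).[y] <= 1.
Proof.
move=> /andP[y0 y1]; rewrite cutoffE.
have h0 : 0 <= 1 - y ^+ n.+1 by rewrite subr_ge0 exprn_ile1.
have h1 : 1 - y ^+ n.+1 <= 1 by rewrite gerBl exprn_ge0.
by rewrite subr_ge0 exprn_ile1//= gerBl exprn_ge0.
Qed.

(** With [m = n.+1] and [N] the outer exponent, [(1 - y^m)^N <= exp (- N y^m)], and [N y^m >= m]
    once [y >= exp (- t)]; finally [exp (- m) <= 1 / m]. *)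
Lemma cutoff_ge t n y : y <= 1 -> expR (- t) <= y ->
  1 - n.+1%:R^-1 <= (cutoff t n).[y].
Proof.
move=> y1 ty; rewrite cutoffE lerD2l lerN2.
have y0 : 0 < y by rewrite (lt_le_trans _ ty)// expR_gt0.
set m := n.+1; set N := (Num.truncn _).+1.
have m0 : 0 < m%:R :> R by rewrite ltr0n.
have h0 : 0 <= 1 - y ^+ m by rewrite subr_ge0 exprn_ile1// ltW.
have : (1 - y ^+ m) ^+ N <= expR (- m%:R).
  apply: (@le_trans _ _ (expR (- y ^+ m) ^+ N)).
    by rewrite lerXn2r ?nnegrE ?expR_ge0// expR_ge1Dx.
  rewrite -expRM_natl ler_expR mulrN lerN2.
  have Nm : m%:R * expR (t * m%:R) <= N%:R by rewrite ltW// truncnS_gt.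
  have ym : expR (- t * m%:R) <= y ^+ m.
    by rewrite mulrC expRM_natl lerXn2r ?nnegrE ?expR_ge0// ltW.
  apply: le_trans (ler_pM _ _ Nm ym); rewrite ?mulr_ge0 ?expR_ge0//.
  by rewrite -mulrA -expRD mulNr subrr expR0 mulr1.
move=> /le_trans; apply.
rewrite expRN lef_pV2 ?posrE ?expR_gt0//.
by rewrite (le_trans _ (expR_ge1Dx _))// lerDr.
Qed.

Lemma Bernoulli_le y N : y <= 1 -> 1 - N%:R * y <= (1 - y) ^+ N.
Proof.
move=> y1; elim: N => [|N IH]; first by rewrite mul0r subr0 expr0.
rewrite exprS; apply: (@le_trans _ _ ((1 - y) * (1 - N%:R * y))).
  by rewrite -natr1; have : 0 <= N%:R * y ^+ 2 by [rewrite mulr_ge0// sqr_ge0]; nra.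
by rewrite ler_wpM2l// subr_ge0.
Qed.

(** By Bernoulli the value is at most [N y^m <= (m exp (t m) + 1) exp (- (t + d) m) <= 2 m exp (- d
    m)], where [1] accounts for rounding [N] up. Then [exp (d m) >= (d m / 2)^2] gives the rate
    [1 / m]. *)
Lemma cutoff_le t n y d : 0 <= t -> 0 < d -> 0 <= y <= expR (- (t + d)) ->
  (cutoff t n).[y] <= 8 / d ^+ 2 / n.+1%:R.
Proof.
move=> t0 d0 /andP[y0 yt]; rewrite cutoffE.
set m := n.+1; set N := (Num.truncn _).+1.
have m0 : 0 < m%:R :> R by rewrite ltr0n.
have m1 : 1 <= m%:R :> R by rewrite ler1n.
have y1 : y ^+ m <= 1.
  by rewrite exprn_ile1// (le_trans yt)// -expR0 ler_expR; lra.
have := Bernoulli_le N y1.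
set z := m%:R * expR (- d * m%:R).
suff : N%:R * y ^+ m <= z + z /\ z <= 4 / d ^+ 2 / m%:R.
  move=> [h1 h2] h3.
  have -> : 8 / d ^+ 2 / m%:R = 2 * (4 / d ^+ 2 / m%:R) by ring.
  by lra.
have Nm : N%:R <= m%:R * expR (t * m%:R) + 1.
  by rewrite /N -natr1 lerD2r truncn_le// mulr_ge0// expR_ge0.
have ym : y ^+ m <= expR (- (t + d) * m%:R).
  by rewrite [_ * m%:R]mulrC expRM_natl lerXn2r ?nnegrE ?expR_ge0.
split.
  apply: (le_trans (ler_pM _ _ Nm ym)); rewrite ?exprn_ge0//.
  rewrite mulrDl mul1r -mulrA -expRD; apply: lerD.
    by rewrite /z; have -> : t * m%:R + - (t + d) * m%:R = - d * m%:R by ring.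
  rewrite /z -[leLHS]mul1r ler_pM ?expR_ge0// ler_expR.
  by rewrite ler_wpM2r// lerN2; lra.
have : (d * m%:R / 2) ^+ 2 <= expR (d * m%:R).
  rewrite (_ : expR (d * m%:R) = expR (2 * (d * m%:R / 2))); last first.
    by congr expR; lra.
  rewrite expRM_natl.
  have dm : 0 <= d * m%:R / 2 by rewrite divr_ge0// mulr_ge0// ltW.
  rewrite lerXn2r ?nnegrE ?expR_ge0//.
  by rewrite (le_trans _ (expR_ge1Dx _))// lerDr.
rewrite /z mulNr expRN => h.
rewrite ler_pdivrMr ?expR_gt0//.
apply: le_trans (ler_wpM2l _ h); last by rewrite !divr_ge0// sqr_ge0.
rewrite le_eqVlt; apply/orP; left; apply/eqP; field; rewrite !gt_eqF//.
Qed.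

End CutOff.

(** * Riemann sums and Laplace transforms of finite measures *)

Section RiemannSum.
Variable R : realType.
Implicit Types (mu : {finite_measure set R -> \bar R}) (f : R -> R).

Local Notation halfline := (`[0, +oo[%classic : set R).

Lemma integrable_bounded_halfline mu f (M : R) : measurable_fun halfline f ->
  (forall x, 0 <= x -> `|f x| <= M) -> mu.-integrable halfline (EFin \o f).
Proof.
move=> mf fM; have mD : measurable halfline by exact: measurable_itv.
apply: (le_integrable mD _ _ (finite_measure_integrable_cst mu M mD)).
  exact/measurable_EFinP.
by move=> x /=; rewrite in_itv/= andbT => x0; rewrite lee_fin (le_trans (fM x x0))// ler_norm.
Qed.

Lemma Rintegral_halfline_cvg mu (fn : nat -> R -> R) f (M : R) :
  (forall n, measurable_fun halfline (fn n)) -> measurable_fun halfline f ->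
  (forall n x, 0 <= x -> `|fn n x| <= M) ->
  (forall x, 0 <= x -> fn ^~ x @ \oo --> f x) ->
  (fun n => \int[mu]_(x in halfline) fn n x : R) @ \oo -->
    (\int[mu]_(x in halfline) f x : R).
Proof.
move=> mfn mf fnM fnf; have mD : measurable halfline by exact: measurable_itv.
have EFin_cvg (u : nat -> R) (l : R) : u @ \oo --> l -> EFin \o u @ \oo --> l%:E.
  by move=> ul; apply: cvg_EFin => //; exact: nearW.
have D0 x : halfline x -> 0 <= x by rewrite /= in_itv/= andbT.
have [iF _] := @dominated_convergence _ _ _ mu halfline mD
  (fun n => EFin \o fn n) (EFin \o f) (cst M%:E)
  (fun n => (measurable_EFinP _ _).2 (mfn n)) ((measurable_EFinP _ _).2 mf)
  (aeW _ (fun x Dx => EFin_cvg _ _ (fnf x (D0 x Dx))))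
  (finite_measure_integrable_cst mu M mD) (aeW _ (fun x n Dx => fnM n x (D0 x Dx))).
by rewrite -(fineK (integrable_fin_num mD iF)) => /fine_cvgP[].
Qed.

(** Intersecting with the half-line makes cell [0] the singleton of [0], so that an atom at [0] is
    counted. *)
Definition cell (n i : nat) : set R :=
  `](i%:R - 1) / n.+1%:R, i%:R / n.+1%:R] `&` halfline.

Lemma measurable_cell n i : measurable (cell n i).
Proof. by apply: measurableI; exact: measurable_itv. Qed.

Lemma cell_sub n i : cell n i `<=` halfline.
Proof. by move=> x []. Qed.

(** The cells cover [[0, n.+1]] with mesh [1 / n.+1], so range and precision improve together. The
    set function is arbitrary, so that real and imaginary parts of complex measures are allowed. *)
Definition riemann_sum (nu : set R -> R) f (n : nat) : R :=
  \sum_(i < (n.+1 ^ 2).+1) f (i%:R / n.+1%:R) * nu (cell n i).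

Lemma cell_uniq n i j x : cell n i x -> cell n j x -> i = j.
Proof.
have n0 : 0 < n.+1%:R :> R by rewrite ltr0n.
have aux i' j' : cell n i' x -> cell n j' x -> (i' <= j')%N.
  move=> []; rewrite /= in_itv/= => /andP[h _] _ [].
  rewrite /= in_itv/= => /andP[_ h'] _.
  have := lt_le_trans h h'.
  by rewrite ltr_pM2r ?invr_gt0// ltrBlDr natr1 ltr_nat ltnS.
by move=> ? ?; apply/eqP; rewrite eqn_leq !aux.
Qed.

Lemma cell_exists n x : 0 <= x -> x <= n.+1%:R ->
  exists2 i : nat, (i < (n.+1 ^ 2).+1)%N & cell n i x.
Proof.
move=> x0 xn; have n0 : 0 < n.+1%:R :> R by rewrite ltr0n.
have [->|xN0] := eqVneq x 0.
  exists 0%N => //; split; rewrite /= in_itv/= ?mul0r ?lexx// andbT.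
  by rewrite sub0r mulNr oppr_lt0 divr_gt0.
have xgt0 : 0 < x by rewrite lt_neqAle eq_sym xN0.
pose y := x * n.+1%:R; have y0 : 0 < y by rewrite mulr_gt0.
have c0 : 0 <= Num.ceil y by rewrite ceil_ge0 (lt_trans _ y0)// ltrN10.
have [i iE] : exists i : nat, Num.ceil y = i%:Z by case: (Num.ceil y) c0 => // i _; exists i.
have iy : y <= i%:R by rewrite -[i%:R]/(i%:Z%:~R) -iE ceil_ge.
have yi : i%:R - 1 < y by have := ceil_itv y; rewrite iE => /andP[]; rewrite intrB.
exists i; last by split; rewrite /= in_itv/= ?x0// ltr_pdivrMr// ler_pdivlMr// iy yi.
rewrite ltnS -ltnS -(ltr_nat R) -natr1 -ltrBlDr (lt_le_trans yi)// -[leRHS]/(_%:R).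
by rewrite /y natrX expr2 ler_pM2r.
Qed.

(** The sums are the integrals of step functions [fn], bounded by [M] and converging pointwise to
    [f]; dominated convergence applies because [mu] is finite. *)
Lemma riemann_sum_cvg mu f (M : R) : continuous f ->
  (forall x, 0 <= x -> `|f x| <= M) ->
  riemann_sum (fun A => fine (mu A)) f @ \oo -->
    (\int[mu]_(x in halfline) f x : R).
Proof.
move=> fc fM.
have mD : measurable halfline by exact: measurable_itv.
pose fn n x : R := \sum_(i < (n.+1 ^ 2).+1) f (i%:R / n.+1%:R) * \1_(cell n i) x.
have mfn n : measurable_fun halfline (fn n).
  apply: measurable_sum => i; apply: measurable_funM => //.
  by apply: measurable_indic; exact: measurable_cell.
have fnE n i x : (i < (n.+1 ^ 2).+1)%N -> cell n i x -> fn n x = f (i%:R / n.+1%:R).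
  move=> il ix; rewrite /fn (bigD1 (Ordinal il))//= indicE mem_set// mulr1.
  rewrite big1 ?addr0// => j /eqP ji; rewrite indicE memNset ?mulr0// => jx.
  by apply: ji; apply/val_inj => /=; exact: cell_uniq ix.
have fn0 n x : (forall i, (i < (n.+1 ^ 2).+1)%N -> ~ cell n i x) -> fn n x = 0.
  by move=> h; rewrite /fn big1// => i _; rewrite indicE memNset ?mulr0//; exact: h.
have M0 : 0 <= M by exact: le_trans (fM 0 (lexx _)).
have fnM n x : `|fn n x| <= M.
  have [[i [il ix]]|h] := pselect (exists i, (i < (n.+1 ^ 2).+1)%N /\ cell n i x).
    by rewrite (fnE _ _ _ il ix) fM// divr_ge0.
  by rewrite fn0 ?normr0// => i il ix; apply: h; exists i.
have fn_cvg x : halfline x -> fn ^~ x @ \oo --> f x.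
  rewrite /= in_itv/= andbT => x0.
  apply/cvgrPdist_lt => e e0.
  have /cvgrPdist_lt/(_ e e0) := fc x.
  move=> /nbhs_ballP[d /= d0 xd].
  near=> n.
  have xn : x <= n.+1%:R.
    near: n; exists (Num.truncn x).+1 => // n /= xn.
    by rewrite (le_trans (ltW (truncnS_gt x)))// ler_nat ltnW.
  have [i il ix] := cell_exists x0 xn.
  rewrite (fnE _ _ _ il ix); apply: xd; rewrite /ball/= distrC.
  case: ix => /=; rewrite in_itv/= => /andP[h1 h2] _.
  have nd : n.+1%:R^-1 < d.
    near: n; exists (Num.truncn d^-1).+1 => // n /= nd.
    rewrite invf_plt ?posrE ?ltr0n//.
    by rewrite (lt_le_trans (truncnS_gt _))// ler_nat ltnW.
  rewrite ger0_norm ?subr_ge0// ltrBlDl.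
  rewrite mulrBl mul1r ltrBlDr in h1.
  by rewrite (lt_trans h1)// ltrD2l.
have mf : measurable_fun halfline f by apply: measurable_funTS; exact: continuous_measurable_fun.
have H := @Rintegral_halfline_cvg mu fn f M mfn mf (fun n x _ => fnM n x).
apply: cvg_trans (H _); last by move=> x x0; apply: fn_cvg; rewrite /= in_itv/= andbT.
apply: near_eq_cvg; apply: nearW => n /=.
rewrite /riemann_sum /Rintegral.
have icell i : mu.-integrable halfline (fun x => (\1_(cell n i) x)%:E).
  apply: (integrableS measurableT) => //.
  by apply: integrable_indic; exact: measurable_cell.
under eq_integral do rewrite /fn -sumEFin; under eq_integral do under eq_bigr do rewrite EFinM.
rewrite (integral_sum mD)//=; last by move=> i; exact: integrableZl.
rewrite -sum_fine/=; last first.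
  move=> i _; rewrite integralZl// integral_indic; last exact: measurable_cell.
  by rewrite fin_numM// fin_num_measure//; apply: measurableI => //; exact: measurable_cell.
  exact: mD.
apply: eq_bigr => i _; rewrite integralZl// integral_indic; last exact: measurable_cell.
rewrite setIidl; last exact: cell_sub.
by rewrite fineM// fin_num_measure//; exact: measurable_cell.
Unshelve. all: by end_near. Qed.

End RiemannSum.

(** * Laplace transforms and polynomials in [exp (- x)] *)

Section Laplace.
Variable R : realType.
Implicit Types (mu : {finite_measure set R -> \bar R}) (f : R -> R) (P : {poly R}).

Local Notation halfline := (`[0, +oo[%classic : set R).

Definition laplace mu (s : R) : R := \int[mu]_(x in halfline) expR (- x * s).

Lemma continuous_expRNM (s : R) : continuous (fun x : R => expR (- x * s)).
Proof.
move=> x; apply: continuous_comp; last exact: continuous_expR.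
by apply: cvgM; [exact: cvgN|exact: cvg_cst].
Qed.

Lemma expRNM_le1 (s x : R) : 0 <= s -> 0 <= x -> `|expR (- x * s)| <= 1.
Proof.
by move=> s0 x0; rewrite ger0_norm ?expR_ge0// -expR0 ler_expR mulNr oppr_le0 mulr_ge0.
Qed.

Lemma integrable_expRNM mu (s : R) : 0 <= s ->
  mu.-integrable halfline (EFin \o (fun x : R => expR (- x * s))).
Proof.
move=> s0; apply: (@integrable_bounded_halfline _ _ _ 1) => [|x x0].
  by apply: measurable_funTS; apply: continuous_measurable_fun; exact: continuous_expRNM.
exact: expRNM_le1.
Qed.

Lemma Rintegral_sum mu (I : Type) (r : seq I) (F : I -> R -> R) :
  (forall i, mu.-integrable halfline (EFin \o F i)) ->
  \int[mu]_(x in halfline) (\sum_(i <- r) F i x) =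
  \sum_(i <- r) \int[mu]_(x in halfline) F i x.
Proof.
move=> iF; have mD : measurable halfline by exact: measurable_itv.
transitivity (fine (\sum_(i <- r) \int[mu]_(x in halfline) (F i x)%:E)%E).
  apply: (congr1 fine); rewrite -(integral_sum mD)//.
  by apply: eq_integral => x _; rewrite sumEFin.
by rewrite -sum_fine// => i _; exact: (integrable_fin_num mD (iF i)).
Qed.

Lemma horner_expRN P (x : R) :
  P.[expR (- x)] = \sum_(i < size P) P`_i * expR (- x * i%:R).
Proof.
rewrite horner_coef; apply: eq_bigr => i _.
by rewrite [_ * i%:R]mulrC expRM_natl.
Qed.

Lemma Rintegral_horner mu P :
  \int[mu]_(x in halfline) P.[expR (- x)] = moment (fun i => laplace mu i%:R) P.
Proof.
have mD : measurable halfline by exact: measurable_itv.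
under eq_Rintegral do rewrite horner_expRN.
rewrite Rintegral_sum => [|i]; last first.
  exact: (integrableZl mD (P`_i) (integrable_expRNM mu (ler0n R i))).
apply: eq_bigr => i _; rewrite RintegralZl//; exact: integrable_expRNM.
Qed.

Lemma measurable_horner_expRN P : measurable_fun halfline (fun x => P.[expR (- x)]).
Proof.
have -> : (fun x : R => P.[expR (- x)]) = (fun x => \sum_(i < size P) P`_i * expR (- x * i%:R)).
  by apply/funext => x; exact: horner_expRN.
apply: measurable_sum => i; apply: measurable_funM => //.
by apply: measurable_funTS; apply: continuous_measurable_fun; exact: continuous_expRNM.
Qed.

Lemma cvg_dist_inv (u : nat -> R) (l K : R) :
  (forall n, `|l - u n| <= K / n.+1%:R) -> u @ \oo --> l.
Proof.
move=> uK; apply/cvgrPdist_le => e e0; near=> n.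
apply: le_trans (uK n) _; rewrite ler_pdivrMr// mulrC -ler_pdivrMr//.
near: n; exists (Num.truncn (K / e)).+1 => // n /= nd.
by rewrite (le_trans (ltW (truncnS_gt _)))// ler_nat ltnW.
Unshelve. all: by end_near. Qed.

Lemma fine_measure_cvg mu (F : nat -> set R) :
  (forall n, measurable (F n)) -> trivIset [set: nat] F ->
  (fun m => \sum_(0 <= i < m) fine (mu (F i))) @ \oo --> fine (mu (\bigcup_k F k)).
Proof.
move=> mF tF; have mUF : measurable (\bigcup_k F k) by exact: bigcup_measurable.
have : (fun m => (\sum_(0 <= i < m) mu (F i))%E) @ \oo --> (fine (mu (\bigcup_k F k)))%:E.
  rewrite fineK; last exact: fin_num_measure.
  exact: measure_semi_sigma_additive.
move=> /fine_cvgP[_]; apply: cvg_trans; apply: near_eq_cvg; apply: nearW => m /=.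
by rewrite sum_fine// => i _; apply: fin_num_measure; exact: mF.
Qed.

Lemma cvgn_sum_scale (I : finType) (c : I -> R) (u : I -> nat -> R) (l : I -> R) :
  (forall j, u j @ \oo --> l j) ->
  (fun m => \sum_j c j * u j m) @ \oo --> \sum_j c j * l j.
Proof.
move=> ul; apply: cvg_big => [|j _]; first exact: add_continuous.
by apply: cvgM; [exact: cvg_cst|exact: ul].
Qed.

Lemma cvgn_eq0 (u : nat -> R) (l : R) : (forall m, u m = 0) -> u @ \oo --> l -> l = 0.
Proof.
by move=> u0; have -> : u = cst 0 by [apply/funext]; move=> /cvg_lim <-//; rewrite lim_cst.
Qed.

(** * Uniqueness from the values at the positive integers *)

Section Combination.
Variables (I : finType) (c : I -> R) (mu : I -> {finite_measure set R -> \bar R}).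
Hypothesis c0 : forall k, \sum_j c j * laplace (mu j) k.+1%:R = 0.

(** Without constant term, [P m] integrates to a combination of Laplace values at positive integers,
    where [c0] applies; dominated convergence passes to the indicator. *)
Lemma combination_eq0_cvg (P : nat -> {poly R}) (B : set R) : measurable B ->
  (forall m, (P m)`_0 = 0) ->
  (forall m y, 0 <= y <= 1 -> 0 <= (P m).[y] <= 1) ->
  (forall x, 0 <= x -> (fun m => (P m).[expR (- x)]) @ \oo --> (\1_B x : R)) ->
  \sum_j c j * fine (mu j (B `&` halfline)) = 0.
Proof.
move=> mB P0 P1 PB; have mD : measurable halfline by exact: measurable_itv.
have cv j : (fun m => \int[mu j]_(x in halfline) (P m).[expR (- x)]) @ \oo -->
    fine (mu j (B `&` halfline)).
  have -> : fine (mu j (B `&` halfline)) = \int[mu j]_(x in halfline) \1_B x.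
    by rewrite /Rintegral integral_indic.
  apply: (@Rintegral_halfline_cvg _ _ _ _ 1) => //.
  - by move=> m; exact: measurable_horner_expRN.
  - move=> m x x0; have /andP[h0 h1] : 0 <= (P m).[expR (- x)] <= 1.
      by apply: P1; rewrite expR_ge0 -expR0 ler_expR oppr_le0.
    by rewrite ger0_norm.
have : (fun m => \sum_j c j * \int[mu j]_(x in halfline) (P m).[expR (- x)]) @ \oo
    --> \sum_j c j * fine (mu j (B `&` halfline)).
  exact: cvgn_sum_scale.
apply: cvgn_eq0 => m.
under eq_bigr do rewrite Rintegral_horner /moment mulr_sumr.
rewrite exchange_big/=; apply: big1 => -[[|i] ilt] _ /=.
  by rewrite P0; apply: big1 => j _; rewrite mul0r mulr0.
by under eq_bigr do rewrite mulrCA; rewrite -mulr_sumr c0 mulr0.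
Qed.

(** The constant [1] has a constant term, so it is reached as the limit of cutoffs whose threshold
    [m] itself goes to infinity. *)
Lemma combination_eq0_halfline :
  \sum_j c j * fine (mu j halfline) = 0.
Proof.
rewrite -(setTI halfline).
apply: (@combination_eq0_cvg (fun m => cutoff m%:R m)) => //.
- by move=> m; exact: cutoff_coef0.
- by move=> m y; exact: cutoff_itv.
move=> x x0; rewrite indicT.
apply/cvgrPdist_le => e e0; near=> m.
have xm : x <= m%:R.
  near: m; exists (Num.truncn x).+1 => // m /= xm.
  by rewrite (le_trans (ltW (truncnS_gt _)))// ler_nat.
have ex : 0 <= expR (- x) <= 1 by rewrite expR_ge0 -expR0 ler_expR oppr_le0.
have /andP[_ h1] := cutoff_itv m%:R m ex.
have h2 : 1 - m.+1%:R^-1 <= (cutoff m%:R m).[expR (- x)].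
  by apply: cutoff_ge; [case/andP: ex|rewrite ler_expR lerN2].
rewrite ger0_norm ?subr_ge0//.
have : m.+1%:R^-1 <= e.
  near: m; exists (Num.truncn e^-1).+1 => // m /= me.
  by rewrite invf_ple ?posrE// (le_trans (ltW (truncnS_gt _)))// ler_nat ltnW.
by apply: le_trans; rewrite lerBlDl -lerBlDr.
Unshelve. all: by end_near. Qed.

(** For [t >= 0] the cutoffs at [t] converge to the indicator at every point, with value [1] at
    [x = t]; for [t < 0] the set is empty. *)
Lemma combination_eq0_le (t : R) :
  \sum_j c j * fine (mu j (`]-oo, t] `&` halfline)) = 0.
Proof.
have [t0|t0] := ltP t 0.
  rewrite (_ : _ `&` _ = set0).
    by apply: big1 => j _; rewrite measure0 mulr0.
  rewrite -subset0 => x [] /=; rewrite !in_itv/= andbT => xt x0.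
  by have := le_lt_trans (le_trans x0 xt) t0; rewrite ltxx.
apply: (@combination_eq0_cvg (fun m => cutoff t m)) => //.
- by move=> m; exact: cutoff_coef0.
- by move=> m y; exact: cutoff_itv.
move=> x x0.
have ex : 0 <= expR (- x) <= 1 by rewrite expR_ge0 -expR0 ler_expR oppr_le0.
have [xt|tx] := leP x t.
  rewrite indicE mem_set/= ?in_itv//=; apply: (@cvg_dist_inv _ _ 1) => m.
  have /andP[_ h1] := cutoff_itv t m ex.
  rewrite ger0_norm ?subr_ge0// div1r.
  have : 1 - m.+1%:R^-1 <= (cutoff t m).[expR (- x)].
    by apply: cutoff_ge; [case/andP: ex|rewrite ler_expR lerN2].
  by rewrite lerBlDl -lerBlDr.
rewrite indicE memNset/= ?in_itv/=; last by apply/negP; rewrite -ltNge.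
apply: (@cvg_dist_inv _ _ (8 / (x - t) ^+ 2)) => m.
have /andP[h0 _] := cutoff_itv t m ex.
rewrite sub0r normrN ger0_norm//.
apply: cutoff_le => //; first by rewrite subr_gt0.
by rewrite expR_ge0 [t + _]addrC subrK lexx.
Qed.

(** The sets on which the combination vanishes are stable under complements and disjoint unions and
    contain the open right rays, an intersection-stable generator of the Borel sets. Finite
    combinations are treated, rather than pairs, because sesquilinearity is a relation between
    several measures. *)
Theorem laplace_combination_eq0 (A : set R) : measurable A ->
  \sum_j c j * fine (mu j (A `&` halfline)) = 0.
Proof.
have mD : measurable halfline by exact: measurable_itv.
have fin j (B : set R) : measurable B -> mu j (B `&` halfline) \is a fin_num.
  by move=> mB; apply: fin_num_measure; exact: measurableI.
have compl (B : set R) : measurable B ->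
    \sum_j c j * fine (mu j (B `&` halfline)) = 0 ->
    \sum_j c j * fine (mu j (~` B `&` halfline)) = 0.
  move=> mB B0; rewrite -[RHS]combination_eq0_halfline -[LHS]add0r -[X in X + _]B0 -big_split/=.
  apply: eq_bigr => j _; rewrite -mulrDr; congr (_ * _).
  rewrite -fineD ?fin//; last exact: measurableC.
  rewrite -measureU//.
  - by rewrite -setIUl setUv setTI.
  - exact: measurableI.
  - by apply: measurableI => //; exact: measurableC.
  - by rewrite setIACA setICr set0I.
move=> mA; move: A mA.
have GE : @measurable _ (measurableTypeR R) = <<s @RGenOInfty.G R >>.
  exact: (RGenOInfty.measurableE R).
move=> A mA.
apply: (@dynkin_induction _ (measurableTypeR R) (@RGenOInfty.G R)
  (fun A => \sum_j c j * fine (mu j (A `&` halfline)) = 0) GE) => //.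
- move=> _ _ [x ->] [y ->]; exists (Num.max x y).
  apply/seteqP; split => z /=; rewrite !in_itv/= !andbT gt_max.
    by move=> [-> ->].
  by move=> /andP[].
- by rewrite setTI combination_eq0_halfline.
- move=> _ [x ->]; rewrite -setCitvl; apply: compl => //.
  exact: combination_eq0_le.
- move=> F mF tF F0; rewrite setI_bigcupl.
  have tFD : trivIset [set: nat] (fun k => F k `&` halfline).
    by apply: trivIset_setIr.
  have cv j : (fun m => \sum_(0 <= i < m) fine (mu j (F i `&` halfline))) @ \oo -->
      fine (mu j (\bigcup_k (F k `&` halfline))).
    by apply: fine_measure_cvg => // i; exact: (measurableI _ _ (mF i) mD).
  have : (fun m => \sum_j c j * \sum_(0 <= i < m) fine (mu j (F i `&` halfline))) @ \oo
      --> \sum_j c j * fine (mu j (\bigcup_k (F k `&` halfline))).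
    exact: cvgn_sum_scale.
  apply: cvgn_eq0 => m.
  under eq_bigr do rewrite mulr_sumr.
  by rewrite exchange_big/=; apply: big1 => i _; exact: F0.
- by rewrite -GE.
Qed.

End Combination.
End Laplace.

(** * Moment problem and Bernstein theorem *)

Section FiniteMeasureOnR.
Variables (R : realType) (mu : {measure set (measurableTypeR R) -> \bar R}).
Variable mufin : fin_num_fun mu.

(** An alias that takes the finiteness proof as an argument, so that the finite measure structure
    can be attached to it; it also transports the measure from [measurableTypeR R] to [R]. *)
Definition finite_copy & fin_num_fun mu : set R -> \bar R := mu.

HB.instance Definition _ := isMeasure.Build _ R R (finite_copy mufin)
  (measure0 mu) (measure_ge0 mu) (@measure_semi_sigma_additive _ _ _ mu).
HB.instance Definition _ := Measure_isFinite.Build _ R _ (finite_copy mufin) mufin.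

Lemma measure_fin_num_finite :
  exists nu : {finite_measure set R -> \bar R}, forall A, nu A = mu A.
Proof. by exists (finite_copy mufin : {finite_measure set R -> \bar R}). Qed.
End FiniteMeasureOnR.

Section StieltjesMeasure.
Variables (R : realType) (F : R -> R) (M : R).
Hypothesis F_nd : {homo F : x y / x <= y}.
Hypothesis F_rc : right_continuous F.
Hypothesis F_ge0 : forall x, 0 <= F x.
Hypothesis F_leM : forall x, F x <= M.

(** The bounds on [F] give every []-n, n]] mass at most [M]; continuity along this increasing union
    bounds the total mass. *)
Lemma finite_stieltjes_measure : exists mu : {finite_measure set R -> \bar R},
  forall a b, a <= b -> mu `]a, b]%classic = (F b - F a)%:E.
Proof.
pose G : cumulative R R := HB.pack F (isCumulative.Build R _ R F F_nd F_rc).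
pose mu : {measure set (measurableTypeR R) -> \bar R} := lebesgue_stieltjes_measure G.
have muE a b : a <= b -> mu `]a, b]%classic = (F b - F a)%:E.
  move=> ab; rewrite /mu/= /lebesgue_stieltjes_measure /measure_extension.
  rewrite measurable_mu_extE/=; last exact: is_ocitv.
  by rewrite wlength_itv_bnd.
have muT : (mu setT <= M%:E)%E.
  rewrite -(bigcup_itvT false false).
  pose I n : set R := `]- (n%:R), n%:R]%classic.
  have : (mu \o I) n @[n --> \oo] --> mu (\bigcup_n I n).
    apply: nondecreasing_cvg_mu; rewrite /I//; first exact: bigcup_measurable.
    by move=> *; apply/subsetPset/subset_itv; rewrite leBSide/= ?lerN2 ler_nat.
  move=> /cvg_lim <-//; apply: lime_le.
    apply: ereal_nondecreasing_is_cvgn => m n mn.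
    have sub : I m `<=` I n.
      move=> x; rewrite /I/= !in_itv/= => /andP[h1 h2]; apply/andP; split.
        by apply: le_lt_trans h1; rewrite lerN2 ler_nat.
      by rewrite (le_trans h2)// ler_nat.
    have mI k : I k \in measurable by rewrite inE; exact: measurable_itv.
    exact: (@le_measure _ _ _ mu _ _ (mI m) (mI n) sub).
  apply: nearW => n /=; rewrite muE ?ge0_cp// lee_fin.
  by have := F_ge0 (- n%:R); have := F_leM n%:R; lra.
have mufin : fin_num_fun mu.
  move=> A mA; rewrite ge0_fin_numE//.
  apply: (@le_lt_trans _ _ (mu setT)); first by apply: le_measure; rewrite ?inE.
  exact: le_lt_trans muT (ltry _).
by have [nu nuE] := measure_fin_num_finite mufin; exists nu => a b ab; rewrite nuE muE.
Qed.
End StieltjesMeasure.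

(** * Distribution function of a positive functional *)

Section Hausdorff.
Variables (R : realType) (a : nat -> R).
Hypothesis pos : forall P : {poly R}, (forall y, 0 <= y <= 1 -> 0 <= P.[y]) -> 0 <= moment a P.

Local Notation halfline := (`[0, +oo[%classic : set R).

(** With [y = exp (- x)], these polynomials dominate the indicator of [[0, t]]. For [t < 0] the
    second condition is void, so [0] qualifies. *)
Definition dominating (t : R) (P : {poly R}) : Prop :=
  (forall y, 0 <= y <= 1 -> 0 <= P.[y]) /\
  (forall y, 0 <= y <= 1 -> expR (- t) <= y -> 1 <= P.[y]).

Definition dist_fun (t : R) : R := inf [set moment a P | P in dominating t].

Lemma moment_le (P Q : {poly R}) : (forall y, 0 <= y <= 1 -> P.[y] <= Q.[y]) ->
  moment a P <= moment a Q.
Proof.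
move=> PQ; rewrite -subr_ge0 -linearB/=; apply: pos => y y01.
by rewrite !hornerE subr_ge0 PQ.
Qed.

Lemma moment0_ge0 : 0 <= a 0%N.
Proof. by rewrite -moment1 pos// => y _; rewrite hornerE. Qed.

Lemma dominating_has_inf t : has_inf [set moment a P | P in dominating t].
Proof.
split; first by exists (moment a 1), 1 => //; split => y _; rewrite hornerE.
by exists 0 => _ [P [P0 _] <-]; exact: pos.
Qed.

Lemma dist_fun_le t P : dominating t P -> dist_fun t <= moment a P.
Proof. by move=> tP; apply: ge_inf; [case: (dominating_has_inf t)|exists P]. Qed.

Lemma dist_fun_approx t e : 0 < e ->
  exists2 P, dominating t P & moment a P < dist_fun t + e.
Proof.
by move=> e0; have [_ [P tP <-] Pe] := inf_adherent e0 (dominating_has_inf t); exists P.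
Qed.

Lemma dist_fun_ge0 t : 0 <= dist_fun t.
Proof.
apply: lb_le_inf; first by case: (dominating_has_inf t).
by move=> _ [P [P0 _] <-]; exact: pos.
Qed.

Lemma dist_fun_le_total t : dist_fun t <= a 0%N.
Proof. by rewrite -moment1; apply: dist_fun_le; split => y _; rewrite hornerE. Qed.

Lemma dist_fun_lt0 t : t < 0 -> dist_fun t = 0.
Proof.
move=> t0; apply/eqP; rewrite eq_le dist_fun_ge0 andbT.
rewrite -[leRHS](linear0 (moment a)); apply: dist_fun_le; split => y.
  by rewrite hornerE.
move=> /andP[_ y1] /le_trans/(_ y1); rewrite -expR0 ler_expR oppr_le0.
by rewrite leNgt t0.
Qed.

Lemma dist_fun_nd : {homo dist_fun : x y / x <= y}.
Proof.
move=> t t' tt'; apply: lb_le_inf; first by case: (dominating_has_inf t').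
move=> _ [P [P0 P1] <-]; apply: dist_fun_le; split => // y y01 ty.
by apply: P1 => //; apply: le_trans ty; rewrite ler_expR lerN2.
Qed.

(** By continuity, a nearly optimal [P] for [t] is still above [1 - e'] slightly beyond [t], so
    [P + e'] dominates there. Near-optimality costs [e'] and the added constant costs [e' * a 0]. *)
Lemma dist_fun_rc : right_continuous dist_fun.
Proof.
move=> t; apply/cvgrPdist_le => e e0.
have [t0|t0] := ltP t 0.
  near=> s; have s0 : s < 0 by near: s; exact: nbhs_right_lt.
  by rewrite !dist_fun_lt0// subrr normr0 ltW.
pose e' := e / (a 0%N + 2).
have a2 : 0 < a 0%N + 2 by have := moment0_ge0; lra.
have e'0 : 0 < e' by rewrite divr_gt0.
have [P tP Pe] := dist_fun_approx t e'0.
have Pt : 1 <= P.[expR (- t)].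
  by apply: tP.2 => //; rewrite expR_ge0 -expR0 ler_expR oppr_le0.
have cP : {for t, continuous (fun s => expR (- s))}.
  by apply: continuous_comp; [exact: cvgN|exact: continuous_expR].
have /cvgrPdist_lt/(_ e' e'0)/nbhs_ballP[d /= d0 Pd] := @continuous_horner _ P (expR (- t)).
have /cvgrPdist_lt/(_ d d0) tnear := cvg_at_right_filter cP.
near=> s.
have ts : t <= s by near: s; exact: nbhs_right_ge.
have st : expR (- t) - expR (- s) < d.
  by apply: le_lt_trans (ler_norm _) _; near: s.
have := dist_fun_nd ts => h; rewrite distrC ger0_norm ?subr_ge0//.
have : dist_fun s <= moment a (P + e'%:P).
  apply: dist_fun_le; split => y y01.
    by rewrite !hornerE addr_ge0// ?tP.1// ltW.
  move=> sy; rewrite !hornerE; have [ty|yt] := leP (expR (- t)) y.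
    by have := tP.2 y y01 ty; lra.
  have : `|P.[expR (- t)] - P.[y]| < e'.
    by apply: Pd; rewrite /ball/= ger0_norm ?subr_ge0 ?ltW//; lra.
  by move=> /ltr_normlW; lra.
rewrite linearD/= -[e'%:P]mulr1 mul_polyC linearZ/= moment1.
have : e' * (a 0%N + 2) = e by rewrite /e' divfK// gt_eqF.
by lra.
Unshelve. all: by end_near. Qed.

(** A cutoff raised by [1 / m.+1] is dominating, and it is small beyond [t + d]; this bounds
    [dist_fun t] by the moment of an explicit polynomial. *)
Lemma dist_fun_cutoff t d e : 0 <= t -> 0 < d -> 0 < e ->
  exists Q, [/\ dist_fun t <= moment a Q,
    (forall y, 0 <= y <= 1 -> Q.[y] <= 1 + e) &
    (forall y, 0 <= y <= 1 -> y <= expR (- (t + d)) -> Q.[y] <= e)].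
Proof.
move=> t0 d0 e0.
(* The summand [8 / d ^+ 2] pays for the tail of the cutoff and [1] for the added constant. *)
pose K := 8 / d ^+ 2 + 1.
have K1 : 1 <= K by rewrite /K lerDr divr_ge0// sqr_ge0.
pose m := Num.truncn (K / e).
have mE : K / m.+1%:R <= e.
  by rewrite ler_pdivrMr// mulrC -ler_pdivrMr// ltW// truncnS_gt.
have mi : m.+1%:R^-1 <= e.
  by apply: le_trans mE; rewrite ler_peMl// invr_ge0.
have m0 : 0 <= m.+1%:R^-1 :> R by rewrite invr_ge0.
exists (cutoff t m + (m.+1%:R^-1)%:P); split.
- apply: dist_fun_le; split => y y01; rewrite hornerD hornerC.
    have /andP[h _] := cutoff_itv t m y01; by rewrite addr_ge0.
  by move=> ty; have /andP[_ y1] := y01; rewrite -lerBlDr; exact: cutoff_ge.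
- move=> y y01; rewrite hornerD hornerC; have /andP[_ h] := cutoff_itv t m y01.
  by rewrite lerD.
- move=> y /andP[y0 _] yt; rewrite hornerD hornerC; apply: le_trans mE.
  rewrite /K mulrDl mul1r lerD2r; apply: cutoff_le => //.
  by rewrite y0 yt.
Qed.

End Hausdorff.

(** Abel summation with the convention that [G] vanishes before index [0]. *)
Lemma sum_by_parts (R : pzRingType) (f G : nat -> R) m :
  \sum_(i < m.+1) f i * (G i - (if (i : nat) is j.+1 then G j else 0)) =
  \sum_(i < m) (f i - f i.+1) * G i + f m * G m.
Proof.
elim: m => [|m IH]; first by rewrite big_ord_recr !big_ord0/= subr0.
rewrite big_ord_recr/= IH [in RHS]big_ord_recr/= mulrBr mulrBl.
by rewrite -!addrA; congr (_ + _); rewrite addrCA [RHS]addrCA; congr (_ + _); rewrite addrC.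
Qed.

(** The intervals []-(n+1), -1/(n+1)]] cover the negative half-line and are null. *)
Lemma measure_lt0_eq0 (R : realType) (mu : {finite_measure set R -> \bar R}) (F : R -> R) :
  (forall x y, x <= y -> mu `]x, y]%classic = (F y - F x)%:E) ->
  (forall x, x < 0 -> F x = 0) -> mu `]-oo, 0[%classic = 0%E.
Proof.
move=> muE F0.
have mI n : measurable (`](- n.+1%:R), - n.+1%:R^-1]%classic : set R).
  exact: measurable_itv.
have sub : (`]-oo, 0[%classic : set R) `<=`
    \bigcup_n (`](- n.+1%:R), - n.+1%:R^-1]%classic : set R).
  move=> x /=; rewrite in_itv/= => x0.
  exists (maxn (Num.truncn (- x)) (Num.truncn (- x)^-1)) => //=.
  have nx0 : 0 < - x by rewrite oppr_gt0.
  rewrite in_itv/= ltrNl lerNr invf_ple ?posrE//.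
  apply/andP; split.
    by rewrite (lt_le_trans (truncnS_gt _))// ler_nat ltnS leq_maxl.
  by rewrite (le_trans (ltW (truncnS_gt _)))// ler_nat ltnS leq_maxr.
apply/eqP; rewrite eq_le measure_ge0 andbT.
apply: le_trans (measure_sigma_subadditive _ mI _ sub) _; first exact: measurable_itv.
rewrite eseries0// => n _ _; rewrite /= muE.
  by rewrite !F0 ?subrr ?oppr_lt0 ?invr_gt0.
by rewrite lerN2 (le_trans (y := 1)) ?invf_le1 ?ler1n.
Qed.

(** * Laplace transform of the Stieltjes measure *)

Section HausdorffMeasure.
Variables (R : realType) (a : nat -> R).
Hypothesis pos : forall P : {poly R}, (forall y, 0 <= y <= 1 -> 0 <= P.[y]) -> 0 <= moment a P.
Variable mu : {finite_measure set R -> \bar R}.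
Hypothesis muE : forall x y, x <= y ->
  mu `]x, y]%classic = (dist_fun a y - dist_fun a x)%:E.

Local Notation halfline := (`[0, +oo[%classic : set R).

(** For [i = 0] the cell is the singleton of [0]; its mass is that of [](-1/(n+1)), 0]], since the
    negative half-line is null. *)
Lemma mu_cell n i : fine (mu (cell n i)) = dist_fun a (i%:R / n.+1%:R) -
  (if i is j.+1 then dist_fun a (j%:R / n.+1%:R) else 0).
Proof.
have n0 : 0 < n.+1%:R :> R by rewrite ltr0n.
case: i => [|i].
  rewrite mul0r subr0 /cell mul0r.
  pose A : set R := `]((0 - 1) / n.+1%:R), 0]%classic.
  have lt0 : (0 - 1) / n.+1%:R < 0 :> R by rewrite sub0r mulNr oppr_lt0 divr_gt0.
  have mA : measurable A by exact: measurable_itv.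
  have /(congr1 fine) : mu A = (dist_fun a 0)%:E.
    by rewrite muE ?ltW// (dist_fun_lt0 pos lt0) subr0.
  rewrite /= => <-.
  pose B : set R := `]-oo, 0[%classic.
  have mB : measurable B by exact: measurable_itv.
  have AE : A = (A `&` halfline) `|` (A `&` B).
    rewrite -setIUr; apply/esym/setIidPl => x _ /=.
    by rewrite !in_itv/= andbT; have [] := leP 0 x; [left|right].
  have AB0 : mu (A `&` B) = 0%E.
    apply/eqP; rewrite eq_le measure_ge0 andbT.
    rewrite -(measure_lt0_eq0 muE (fun x => dist_fun_lt0 pos (t := x))).
    by apply: le_measure; rewrite ?inE//; exact: measurableI.
  rewrite [in RHS]AE measureU//; [|exact: measurableI|exact: measurableI|].
    by rewrite [X in fine (_ + X)](_ : _ = 0%E) ?adde0//; exact: AB0.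
  rewrite setIACA (_ : halfline `&` B = set0) ?setI0// -subset0 => x [] /=.
  by rewrite !in_itv/= andbT => x0 /(le_lt_trans x0); rewrite ltxx.
have -> : cell n i.+1 = `](i%:R / n.+1%:R), (i.+1%:R / n.+1%:R)]%classic :> set R.
  rewrite /cell -natr1 addrK; apply: setIidl => x /=; rewrite !in_itv/= andbT.
  by move=> /andP[/ltW + _]; apply: le_trans; rewrite divr_ge0.
by rewrite muE// ler_pM2r ?invr_gt0// ler_nat.
Qed.

Section Estimate.
Variables (k n : nat).
Let N : R := n.+1%:R.
Let f (i : nat) : R := expR (- (i%:R / N) * k.+1%:R).
Let G (i : nat) : R := dist_fun a (i%:R / N).
(** The drop of [exp (- k.+1 * x)] over one grid step. Below, [E] is the ratio of consecutive values
    of [f], hence also of [c]: shifting an index costs a factor [E], which is close to [1] for large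
    [n]. *)
Let c i := f i - f i.+1.
Let E := expR (k.+1%:R / N).

Let N0 : 0 < N. Proof. by rewrite ltr0n. Qed.

Let f_step i : f i = E * f i.+1.
Proof.
rewrite /f /E -expRD; congr expR.
by rewrite -[i.+1%:R]natr1; field; rewrite gt_eqF.
Qed.

Let f_ge0 i : 0 <= f i. Proof. exact: expR_ge0. Qed.

Let f_nd i : f i.+1 <= f i.
Proof.
by rewrite ler_expR ler_wpM2r// lerN2 ler_wpM2r ?invr_ge0 ?(ltW N0)// ler_nat.
Qed.

Let c_ge0 i : 0 <= c i. Proof. by rewrite subr_ge0. Qed.

Let c_step i : c i = E * c i.+1. Proof. by rewrite /c (f_step i) (f_step i.+1); ring. Qed.

Let f0 : f 0%N = 1. Proof. by rewrite /f mul0r oppr0 mul0r expR0. Qed.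

Let fE i : f i = expR (- (i%:R / N)) ^+ k.+1.
Proof. by rewrite -expRM_natl mulrC. Qed.

Let c_sum m : \sum_(i < m) c i <= 1.
Proof.
suff -> : \sum_(i < m) c i = f 0%N - f m by rewrite f0 gerBl.
elim: m => [|m IH]; first by rewrite big_ord0 subrr.
by rewrite big_ord_recr/= IH /c; ring.
Qed.

Let c_sum1 m : \sum_(i < m) c i.+1 <= 1.
Proof.
apply: le_trans (c_sum m.+1).
by rewrite big_ord_recl/= lerDr.
Qed.

(** Cut [z = y ^+ k.+1] into the layers [min z (f i) - min z (f i.+1)]. A layer is at most [c i],
    and is zero unless [y > exp (- i.+1 / N)], where a polynomial dominating at [i.+1 / N] is at
    least [1]. *)
Lemma moment_le_sum m :
  a k.+1 <= \sum_(i < m) c i * G i.+1 + f m * a 0%N.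
Proof.
apply/ler_addgt0Pr => e e0.
have /choice[P HP] : forall i : nat, exists Q : {poly R},
    dominating (i.+1%:R / N) Q /\ moment a Q <= G i.+1 + e.
  move=> i; have [Q tQ Qe] := dist_fun_approx pos (i.+1%:R / N) e0.
  by exists Q; split => //; exact: ltW.
have /(moment_le pos) : forall y, 0 <= y <= 1 ->
    ('X^(k.+1) : {poly R}).[y] <= (\sum_(i < m) c i *: P i + f m *: 1).[y].
  move=> y y01; have /andP[y0 y1] := y01.
  rewrite hornerXn hornerD hornerZ hornerE mulr1 horner_sum.
  pose z := y ^+ k.+1.
  have cP i : Num.min z (f i) - Num.min z (f i.+1) <= (c i *: P i).[y].
    rewrite hornerZ; have [zf|fz] := leP z (f i.+1).
      rewrite (min_idPl (le_trans zf (f_nd i))) subrr mulr_ge0//.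
      exact: (HP i).1.1.
    have : 1 <= (P i).[y].
      apply: (HP i).1.2 => //; rewrite -(@ler_pXn2r _ k.+1) ?nnegrE ?expR_ge0//.
      by rewrite -fE ltW.
    move=> /(ler_wpM2l (c_ge0 i)); rewrite mulr1; apply: le_trans.
    by rewrite lerD2r ge_min lexx orbT.
  have tel m' : Num.min z (f 0%N) - Num.min z (f m') <= \sum_(i < m') (c i *: P i).[y].
    elim: m' => [|m' IH]; first by rewrite subrr big_ord0.
    by rewrite big_ord_recr/=; have := cP m'; lra.
  have := tel m; rewrite f0 (min_idPl _) ?exprn_ile1//.
  have : Num.min z (f m) <= f m by rewrite ge_min lexx orbT.
  by rewrite -/z; lra.
rewrite momentXn linearD/= linearZ/= moment1 linear_sum/= => /le_trans; apply.
rewrite addrAC lerD2r.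
apply: (@le_trans _ _ (\sum_(i < m) (c i * G i.+1 + c i * e))).
  apply: ler_sum => i _; rewrite linearZ/= -mulrDr ler_wpM2l//.
  exact: (HP i).2.
rewrite big_split/= lerD2l -mulr_suml.
by rewrite ler_piMl ?c_sum// ltW.
Qed.

(** The same layers bound from below. The polynomial for [i / N] is only known to be small beyond
    [i.+1 / N], so it is paired with the next layer, of height [c i.+1]. *)
Lemma sum_le_moment m : \sum_(i < m) c i.+1 * G i <= a k.+1.
Proof.
apply/ler_addgt0Pr => e' e'0.
pose e := e' / (a 0%N + 1).
have a1 : 0 < a 0%N + 1 by have := moment0_ge0 pos; lra.
have e0 : 0 < e by rewrite divr_gt0.
have /choice[Q HQ] : forall i : nat, exists Q : {poly R},
   [/\ G i <= moment a Q,
    (forall y, 0 <= y <= 1 -> Q.[y] <= 1 + e) &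
    (forall y, 0 <= y <= 1 -> y <= expR (- (i%:R / N + 1 / N)) -> Q.[y] <= e)].
  move=> i; apply: dist_fun_cutoff => //; first by rewrite divr_ge0// ltW.
  by rewrite divr_gt0.
have /(moment_le pos) : forall y, 0 <= y <= 1 ->
    (\sum_(i < m) c i.+1 *: Q i).[y] <= ('X^(k.+1) + e *: 1 : {poly R}).[y].
  move=> y y01; have /andP[y0 y1] := y01.
  rewrite hornerD hornerXn hornerZ hornerE mulr1 horner_sum.
  pose z := y ^+ k.+1.
  have z0 : 0 <= z by rewrite exprn_ge0.
  have cQ i : (c i.+1 *: Q i).[y] <=
      Num.min z (f i.+1) - Num.min z (f i.+2) + c i.+1 * e.
    have [_ Q1 Qe] := HQ i; rewrite hornerZ; have [zf|fz] := leP z (f i.+1).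
      have mz : Num.min z (f i.+2) <= z by rewrite ge_min lexx.
      have : (Q i).[y] <= e.
        apply: Qe => //; rewrite -mulrDl natr1.
        by rewrite -(@ler_pXn2r _ k.+1) ?nnegrE ?expR_ge0// -fE.
      by move=> /(ler_wpM2l (c_ge0 i.+1)); lra.
    have mz : Num.min z (f i.+2) <= f i.+2 by rewrite ge_min lexx orbT.
    have := ler_wpM2l (c_ge0 i.+1) (Q1 y y01).
    by rewrite mulrDr mulr1 {2}/c; lra.
  have tel m' : \sum_(i < m') (c i.+1 *: Q i).[y] <=
      Num.min z (f 1%N) - Num.min z (f m'.+1) + (\sum_(i < m') c i.+1) * e.
    elim: m' => [|m' IH]; first by rewrite subrr !big_ord0 mul0r addr0.
    by rewrite !big_ord_recr/= mulrDl; have := cQ m'; lra.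
  have h1 : Num.min z (f 1%N) <= z by rewrite ge_min lexx.
  have h2 : 0 <= Num.min z (f m.+1) by rewrite le_min z0 f_ge0.
  have h3 : (\sum_(i < m) c i.+1) * e <= e by rewrite ler_piMl ?c_sum1// ltW.
  by have := tel m; rewrite -/z; lra.
rewrite linearD/= momentXn linearZ/= moment1 linear_sum/= => h.
have : e * a 0%N <= e'.
  rewrite /e -mulrA ler_piMr ?(ltW e'0)// ler_pdivrMl// mulr1.
  by lra.
suff : \sum_(i < m) c i.+1 * G i <= \sum_(i < m) moment a (c i.+1 *: Q i) by lra.
apply: ler_sum => i _; rewrite linearZ/= ler_wpM2l//.
by have [] := HQ i.
Qed.

(** Abel summation turns [S] into a sum of [c i * G i]; the two preceding bounds involve the same
    sum with an index shifted, at the cost of [E]. The remainder [r] is the value of [f] at the last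
    grid point [N]. *)
Lemma riemann_sum_estimate :
  let S := riemann_sum (fun A => fine (mu A)) (fun x => expR (- x * k.+1%:R)) n in
  let r := expR (- N * k.+1%:R) in
  a k.+1 <= E * S + r * a 0%N /\ S <= E * a k.+1 + r * a 0%N.
Proof.
move=> S r; pose M := (n.+1 ^ 2)%N.
have SE : S = \sum_(i < M) c i * G i + f M * G M.
  rewrite -sum_by_parts /S /riemann_sum; apply: eq_bigr => i _.
  by rewrite mu_cell /f; congr (_ * _); case: (i : nat).
have fM : f M = r.
  rewrite /f /r; congr (expR (- _ * _)).
  by rewrite /M natrX expr2 mulfK// gt_eqF.
have G_ge0 i : 0 <= G i by exact: dist_fun_ge0.
have Ga i : G i <= a 0%N by exact: dist_fun_le_total.
have E0 : 0 <= E by exact: expR_ge0.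
split.
  apply: (le_trans (moment_le_sum M)); rewrite fM lerD2r SE.
  have -> : \sum_(i < M) c i * G i.+1 = E * \sum_(i < M) c i.+1 * G i.+1.
    by rewrite mulr_sumr; apply: eq_bigr => i _; rewrite mulrA -c_step.
  rewrite ler_wpM2l//.
  apply: (@le_trans _ _ (\sum_(i < M.+1) c i * G i)).
    by rewrite [leRHS]big_ord_recl/= lerDr mulr_ge0.
  by rewrite big_ord_recr/= lerD2l ler_wpM2r// /c gerBl.
rewrite SE fM lerD//; last by rewrite ler_wpM2l// expR_ge0.
have -> : \sum_(i < M) c i * G i = E * \sum_(i < M) c i.+1 * G i.
  by rewrite mulr_sumr; apply: eq_bigr => i _; rewrite mulrA -c_step.
by rewrite ler_wpM2l// sum_le_moment.
Qed.
End Estimate.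

Lemma cvgn_expRN (x : R) : 0 < x -> (fun n => expR (- n.+1%:R * x)) @ \oo --> (0 : R).
Proof.
move=> x0; apply: (@cvg_dist_inv _ _ _ x^-1) => n.
rewrite sub0r normrN ger0_norm ?expR_ge0// mulNr expRN -invfM lef_pV2 ?posrE ?mulr_gt0 ?expR_gt0//.
by rewrite (le_trans _ (expR_ge1Dx _))// mulrC lerDr.
Qed.

(** In [riemann_sum_estimate], [E] tends to [1], [r] to [0] and the Riemann sums to the integral. *)
Theorem dist_fun_laplace k : laplace mu k.+1%:R = a k.+1.
Proof.
pose S n := riemann_sum (fun A => fine (mu A)) (fun x => expR (- x * k.+1%:R)) n.
pose E n : R := expR (k.+1%:R / n.+1%:R).
pose r n : R := expR (- n.+1%:R * k.+1%:R).
have Sc : S @ \oo --> laplace mu k.+1%:R.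
  apply: (@riemann_sum_cvg _ mu _ 1); first exact: continuous_expRNM.
  by move=> x x0; exact: expRNM_le1.
have Ec : E @ \oo --> (1 : R).
  rewrite -expR0 -[X in expR X](mulr0 k.+1%:R); apply: continuous_cvg.
    exact: continuous_expR.
  by apply: cvgM; [exact: cvg_cst|exact: cvg_harmonic].
have rc : r @ \oo --> (0 : R) by exact: cvgn_expRN.
apply/eqP; rewrite eq_le; apply/andP; split.
  have R1 : (fun n => E n * a k.+1 + r n * a 0%N) @ \oo --> 1 * a k.+1 + 0 * a 0%N.
    by apply: cvgD; apply: cvgM => //; exact: cvg_cst.
  rewrite mul1r mul0r addr0 in R1.
  by apply: ler_cvg_to Sc R1 _; apply: nearW => n; case: (riemann_sum_estimate k n).
have R1 : (fun n => E n * S n + r n * a 0%N) @ \oo --> 1 * laplace mu k.+1%:R + 0 * a 0%N.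
  by apply: cvgD; apply: cvgM => //; exact: cvg_cst.
rewrite mul1r mul0r addr0 in R1.
apply: ler_cvg_to (cvg_cst (a k.+1)) R1 _.
by apply: nearW => n; case: (riemann_sum_estimate k n).
Qed.
End HausdorffMeasure.

(** Index [0] is excluded: mass at [y = 0] would sit at [x = +oo], outside the half-line, and only
    [a 0] would see it. *)
Theorem hausdorff_laplace (R : realType) (a : nat -> R) (C : R) :
  (forall n, `|a n| <= C) ->
  (forall P, 0 <= moment a (P ^+ 2)) -> (forall P, 0 <= moment a ('X * P ^+ 2)) ->
  exists mu : {finite_measure set R -> \bar R},
    forall k, laplace mu k.+1%:R = a k.+1.
Proof.
move=> aC sqr Xsqr.
have pos (P : {poly R}) : (forall y, 0 <= y <= 1 -> 0 <= P.[y]) -> 0 <= moment a P.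
  by apply: moment_ge0 => m n; exact: moment_Bernstein_ge0 aC sqr Xsqr _ _.
have [mu muE] := finite_stieltjes_measure (dist_fun_nd pos) (dist_fun_rc pos)
  (dist_fun_ge0 pos) (dist_fun_le_total pos).
by exists mu => k; exact: dist_fun_laplace muE k.
Qed.

(** * Dilations of a finite measure *)

Section Dilation.
Variable R : realType.
Variables (mu : {finite_measure set R -> \bar R}) (h : R).

Definition dilation : set R -> \bar R := pushforward mu (fun x : R => x * h : R).

Lemma measurable_dilation : measurable_fun [set: R] (fun x : R => x * h : R).
Proof. exact: measurable_funM. Qed.

Let dilation_preimage (A : set R) : measurable A -> measurable ((fun x : R => x * h) @^-1` A).
Proof. by move=> mA; rewrite -[X in measurable X]setTI; exact: measurable_dilation. Qed.

Let dilation0 : dilation set0 = 0%E.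
Proof. by rewrite /dilation /pushforward preimage_set0 measure0. Qed.

Let dilation_ge0 A : (0 <= dilation A)%E.
Proof. exact: (measure_ge0 mu). Qed.

Let dilation_sigma_additive : semi_sigma_additive dilation.
Proof.
move=> F mF tF mUF; rewrite /dilation /pushforward preimage_bigcup.
apply: measure_semi_sigma_additive.
- by move=> n; exact: dilation_preimage.
- apply/trivIsetP => /= i j _ _ ij; rewrite -preimage_setI.
  by move/trivIsetP : tF => /(_ _ _ _ _ ij) ->//; rewrite preimage_set0.
- by rewrite -preimage_bigcup; exact: dilation_preimage.
Qed.

HB.instance Definition _ := isMeasure.Build _ R R
  dilation dilation0 dilation_ge0 dilation_sigma_additive.

Let dilation_fin : fin_num_fun dilation.
Proof. by move=> A mA; apply: fin_num_measure; exact: dilation_preimage. Qed.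

HB.instance Definition _ := Measure_isFinite.Build _ R _ dilation dilation_fin.
End Dilation.

(** * Bounded positive definite functions on the half-line *)

Section Bernstein_pd.
Variable R : realType.
Implicit Types mu nu : {finite_measure set R -> \bar R}.

Local Notation halfline := (`[0, +oo[%classic : set R).

(** The combination with coefficients [1] and [-1] shows that the measures agree on Borel subsets of
    the half-line, so their Riemann sums coincide. *)
Lemma laplace_inj mu nu : (forall k, laplace mu k.+1%:R = laplace nu k.+1%:R) ->
  forall s, 0 <= s -> laplace mu s = laplace nu s.
Proof.
move=> mn s s0.
pose c (j : 'I_2) : R := if j == 0 then 1 else -1.
pose rho (j : 'I_2) := if j == 0 then mu else nu.
have c0 k : \sum_(j < 2) c j * laplace (rho j) k.+1%:R = 0.
  by rewrite !big_ord_recr big_ord0 /c /rho/= add0r mul1r mulN1r mn subrr.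
have eqA (A : set R) : measurable A -> A `<=` halfline -> fine (mu A) = fine (nu A).
  move=> mA AD; have := laplace_combination_eq0 c0 mA.
  rewrite (setIidl AD) !big_ord_recr big_ord0 /c /rho/= add0r mul1r mulN1r.
  by move=> /eqP; rewrite subr_eq0 => /eqP.
have cvL (m : {finite_measure set R -> \bar R}) :
    riemann_sum (fun A => fine (m A)) (fun x => expR (- x * s)) @ \oo --> laplace m s.
  apply: (@riemann_sum_cvg _ m _ 1); first exact: continuous_expRNM.
  by move=> x x0; exact: expRNM_le1.
have /cvg_lim <- := cvL mu; last by [].
have /cvg_lim <- := cvL nu; last by [].
congr (lim (_ @ \oo)); apply/funext => n; apply: eq_bigr => i _; rewrite eqA//.
- exact: measurable_cell.
- exact: cell_sub.
Qed.

Lemma laplace_scale mu (h : R) : 0 < h ->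
  exists nu, forall s, 0 <= s -> laplace nu s = laplace mu (s / h).
Proof.
move=> h0; exists (dilation mu h^-1) => s s0.
rewrite /laplace /Rintegral; congr fine.
have mf : measurable_fun halfline (fun x : R => (expR (- x * s))%:E).
  apply/measurable_EFinP; apply: measurable_funTS; apply: continuous_measurable_fun.
  exact: continuous_expRNM.
have mD : measurable halfline by exact: measurable_itv.
transitivity (\int[pushforward mu (fun x : R => (x * h^-1)%R : R)]_(x in halfline)
  (expR (- x * s)%R)%:E)%E; first by [].
rewrite (ge0_integral_pushforward (measurable_dilation h^-1))//.
have -> : (fun x : R => x * h^-1) @^-1` halfline = halfline.
  apply/seteqP; split => x /=; rewrite !in_itv/= !andbT.
    by rewrite pmulr_lge0 ?invr_gt0.
  by move=> x0; rewrite divr_ge0// ltW.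
by apply: eq_integral => x _ /=; congr (expR _)%:E; rewrite -!mulNr; ring.
Qed.

Lemma laplace_cvg mu (u : nat -> R) (s : R) : (forall n, 0 <= u n) ->
  u @ \oo --> s -> (fun n => laplace mu (u n)) @ \oo --> laplace mu s.
Proof.
move=> u0 us; have mE (r : R) : measurable_fun halfline (fun x : R => expR (- x * r)).
  by apply: measurable_funTS; apply: continuous_measurable_fun; exact: continuous_expRNM.
apply: (@Rintegral_halfline_cvg _ mu (fun n x => expR (- x * u n)) _ 1) => //.
  by move=> n x x0; exact: expRNM_le1.
move=> x x0; apply: continuous_cvg; first exact: continuous_expR.
by apply: cvgM => //; exact: cvg_cst.
Qed.

Section Bernstein.
Variables (g : R -> R) (C : R).
Hypothesis g_cont : continuous g.
Hypothesis g_bnd : forall s, `|g s| <= C.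
Hypothesis g_pd : forall n (s c : 'I_n -> R), (forall j, 0 < s j) ->
  0 <= \sum_(j < n) \sum_(k < n) c j * c k * g (s j + s k).

Lemma pd_lattice_laplace (h : R) : 0 < h ->
  exists mu, forall k, laplace mu k.+1%:R = g (k.+1%:R * h).
Proof.
move=> h0.
apply: (@hausdorff_laplace R (fun n => g (n%:R * h)) C) => [n|P|P]; first exact: g_bnd.
- rewrite moment_sqr.
  (* Positive definiteness only covers positive points, while [P ^+ 2] involves the point [0]; the
     points are shifted by [1 / m.+1] and continuity removes the shift. *)
  have cv : (fun m => \sum_(i < size P) \sum_(j < size P)
        P`_i * P`_j * g ((i%:R * h + m.+1%:R^-1) + (j%:R * h + m.+1%:R^-1))) @ \oo -->
      \sum_(i < size P) \sum_(j < size P) P`_i * P`_j * g ((i + j)%:R * h).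
    apply: cvg_big => [|i _]; first exact: add_continuous.
    apply: cvg_big => [|j _]; first exact: add_continuous.
    apply: cvgM; first exact: cvg_cst.
    apply: continuous_cvg; first exact: g_cont.
    rewrite natrD mulrDl -[X in _ --> X + _]addr0 -[X in _ --> _ + X]addr0.
    by apply: cvgD; (apply: cvgD; [exact: cvg_cst|exact: cvg_harmonic]).
  apply: ler_cvg_to (cvg_cst 0) cv _; apply: nearW => m.
  apply: g_pd => j; rewrite ltr_wpDl ?invr_gt0//.
  by rewrite mulr_ge0// ltW.
- rewrite -['X]expr1 moment_shift moment_sqr.
  (* The factor ['X] is split evenly: each point is moved by [h / 2]. *)
  have := @g_pd (size P) (fun i => i%:R * h + h / 2) (fun i => P`_i) _.
  have -> : \sum_(j < size P) \sum_(k < size P)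
      P`_j * P`_k * g (j%:R * h + h / 2 + (k%:R * h + h / 2)) =
    \sum_(i < size P) \sum_(j < size P) P`_i * P`_j * g ((1 + (i + j))%:R * h).
    apply: eq_bigr => i _; apply: eq_bigr => j _; congr (_ * g _).
    by rewrite !natrD; field.
  apply => j; rewrite ltr_wpDl ?divr_gt0// mulr_ge0// ltW//.
Qed.

(** The measure [mu] comes from step [1]. The measure for step [1 / m.+1], suitably dilated, agrees
    with it at the positive integers, hence everywhere, so [laplace mu] equals [g] at positive
    rationals; continuity gives the rest. *)
Theorem bernstein_pd : exists mu, forall s, 0 <= s -> laplace mu s = g s.
Proof.
have [mu muE] := pd_lattice_laplace ltr01.
exists mu.
have rat k m : laplace mu (k.+1%:R / m.+1%:R) = g (k.+1%:R / m.+1%:R).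
  have h0 : 0 < m.+1%:R^-1 :> R by rewrite invr_gt0.
  have [mu' mu'E] := pd_lattice_laplace h0.
  have [nu nuE] := laplace_scale mu' h0.
  rewrite (@laplace_inj mu nu) => [|j|]; [|rewrite nuE// muE mulr1|exact: divr_ge0].
    rewrite nuE ?divr_ge0//.
    by rewrite mulfK ?gt_eqF// mu'E.
  rewrite invrK -natrM.
  have -> : (j.+1 * m.+1)%N = (j.+1 * m.+1).-1.+1 by [].
  by rewrite mu'E prednK ?muln_gt0// natrM mulfK// gt_eqF.
(* Rational approximations from above have positive numerators, so [s = 0] is reached as well. *)
move=> s s0; pose u n : R := (Num.truncn (s * n.+1%:R)).+1%:R / n.+1%:R.
have us : u @ \oo --> s.
  apply: (@cvg_dist_inv _ _ _ 1) => n; have n0 : 0 < n.+1%:R :> R by [].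
  have y0 : 0 <= s * n.+1%:R by rewrite mulr_ge0.
  rewrite distrC ger0_norm.
    rewrite ler_pdivlMr// mulrBl /u divfK ?gt_eqF//.
    by rewrite lerBlDl -[leLHS]natr1 lerD2r truncn_le.
  by rewrite subr_ge0 /u ler_pdivlMr// ltW// truncnS_gt.
have u0 n : 0 <= u n by rewrite divr_ge0.
have := @laplace_cvg mu u s u0 us.
have -> : (fun n => laplace mu (u n)) = (fun n => g (u n)) by apply/funext => n; exact: rat.
have gu : (fun n => g (u n)) @ \oo --> g s by apply: continuous_cvg => //; exact: g_cont.
by move=> lu; apply: (cvg_unique _ lu gu).
Qed.
End Bernstein.
End Bernstein_pd.

(** * Hilbert space operators *)

Local Notation Re := complex.Re.
Local Notation Im := complex.Im.

Section HilbertSpace.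
Variables (R : realType) (F : completeNormedModType R[i]).
Variable dot : {dot F for Num.conj}.
Hypothesis hdot : hilbert_dot dot.
Local Notation sp := (sprod dot).

Lemma sprodDr v w w' : sp v (w + w') = sp v w + sp v w'.
Proof. exact: linearDl. Qed.

Lemma sprodZr a v w : sp v (a *: w) = a * sp v w.
Proof. exact: linearZl_LR. Qed.

Lemma sprodDl v v' w : sp (v + v') w = sp v w + sp v' w.
Proof. exact: linearDr. Qed.

Lemma sprodZl a v w : sp (a *: v) w = conjc a * sp v w.
Proof. exact: linearZr_LR. Qed.

Lemma sprodC v w : sp v w = conjc (sp w v).
Proof. by rewrite /sprod hermC expr0 mul1r. Qed.

Lemma sprodBr v w w' : sp v (w - w') = sp v w - sp v w'.
Proof. by rewrite -scaleN1r sprodDr sprodZr mulN1r. Qed.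

Definition rnorm (v : F) : R := Re `|v|.

Lemma normE v : `|v| = (rnorm v)%:C.
Proof. by rewrite /rnorm RRe_real// normr_real. Qed.

Lemma rnorm_ge0 v : 0 <= rnorm v.
Proof. by rewrite -ler0c -normE normr_ge0. Qed.

Lemma sprod_norm v : sp v v = (rnorm v ^+ 2)%:C.
Proof. by rewrite /sprod -hdot normE rmorphXn. Qed.

Lemma sprod_eq v w : (forall u, sp u v = sp u w) -> v = w.
Proof.
move=> h; apply/eqP; rewrite -subr_eq0 -normr_eq0; apply/eqP.
have /eqP : sp (v - w) (v - w) = 0 by rewrite sprodBr h subrr.
by rewrite /sprod -hdot sqrf_eq0 => /eqP.
Qed.

(** The underlying real scalar product: Riesz representation is proved for real functionals first
    and made complex afterwards. *)
Definition rdot (v w : F) : R := Re (sp v w).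

Lemma ReD (x y : R[i]) : Re (x + y) = Re x + Re y.
Proof. by case: x y => [? ?] []. Qed.

Lemma ReZ (t : R) (x : R[i]) : Re (t%:C * x) = t * Re x.
Proof. by case: x => [a b] /=; rewrite mul0r subr0. Qed.

Lemma rdotC v w : rdot v w = rdot w v.
Proof. by rewrite /rdot sprodC; case: (sp w v). Qed.

Lemma rdotDr v w w' : rdot v (w + w') = rdot v w + rdot v w'.
Proof. by rewrite /rdot sprodDr ReD. Qed.

Lemma rdotZr t v w : rdot v (t%:C *: w) = t * rdot v w.
Proof. by rewrite /rdot sprodZr ReZ. Qed.

Lemma rdotDl v w w' : rdot (w + w') v = rdot w v + rdot w' v.
Proof. by rewrite !(rdotC _ v) rdotDr. Qed.

Lemma rdotZl t v w : rdot (t%:C *: w) v = t * rdot w v.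
Proof. by rewrite !(rdotC _ v) rdotZr. Qed.

Lemma rdotNr v w : rdot v (- w) = - rdot v w.
Proof.
have := rdotZr (-1) v w; rewrite mulN1r => <-.
by rewrite -scaleN1r rmorphN1.
Qed.

Lemma rdotNl v w : rdot (- w) v = - rdot w v.
Proof. by rewrite !(rdotC _ v) rdotNr. Qed.

Lemma rdot_norm v : rdot v v = rnorm v ^+ 2.
Proof. by rewrite /rdot sprod_norm. Qed.

(** Cauchy-Schwarz: expand the squared norm of [|w| v - |v| w] and divide by [2 |v| |w|], the null
    cases being separate. *)
Lemma rdot_le v w : rdot v w <= rnorm v * rnorm w.
Proof.
have [v0|v0] := eqVneq (rnorm v) 0.
  rewrite (_ : v = 0) ?v0 ?mul0r.
    have := rdotZl 0 w 0; rewrite mul0r scaler0 => ->.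
    by rewrite mulr_ge0// rnorm_ge0.
  by apply/eqP; rewrite -normr_eq0 normE v0.
have [w0|w0] := eqVneq (rnorm w) 0.
  rewrite (_ : w = 0) ?w0 ?mulr0.
    have := rdotZr 0 v 0; rewrite mul0r scaler0 => ->.
    by rewrite mulr_ge0// rnorm_ge0.
  by apply/eqP; rewrite -normr_eq0 normE w0.
have st : 0 < rnorm v * rnorm w.
  by rewrite mulr_gt0// lt_neqAle eq_sym ?v0 ?w0 rnorm_ge0.
have : 0 <= rdot ((rnorm w)%:C *: v - (rnorm v)%:C *: w) ((rnorm w)%:C *: v - (rnorm v)%:C *: w).
  by rewrite rdot_norm sqr_ge0.
rewrite !rdotDl !rdotDr !rdotNl !rdotNr !rdotZl !rdotZr (rdotC w v) !rdot_norm.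
set s := rnorm v; set t := rnorm w; set x := rdot v w.
have -> : t * (t * s ^+ 2) - t * (s * x) + (- (s * (t * x)) - - (s * (s * t ^+ 2))) =
  (s * t) * (2 * (s * t - x)) by ring.
by rewrite pmulr_rge0// pmulr_rge0// subr_ge0.
Qed.

Lemma norm_rdot_le v w : `|rdot v w| <= rnorm v * rnorm w.
Proof.
rewrite ler_norml rdot_le andbT lerNl -rdotNr (le_trans (rdot_le _ _))//.
by rewrite /rnorm normrN.
Qed.

Lemma rdot_cvg (T : Type) (G : set_system T) {FG : Filter G} (w : F) (u : T -> F) (l : F) :
  u @ G --> l -> (fun n => rdot w (u n)) @ G --> rdot w l.
Proof.
move=> ul; apply/cvgrPdist_le => e e0.
have w1 : 0 < rnorm w + 1 by rewrite ltr_wpDl// rnorm_ge0.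
pose d := e / (rnorm w + 1); have d0 : 0 < d by rewrite divr_gt0.
have /cvgrPdist_lt/(_ d%:C) := ul; rewrite ltcR => /(_ d0).
apply: filterS => n; rewrite normE ltcR => un.
rewrite -rdotNr -rdotDr (le_trans (norm_rdot_le _ _))//.
have : rnorm w * rnorm (l - u n) <= (rnorm w + 1) * d.
  by rewrite ler_pM ?rnorm_ge0// ?lerDl// ltW.
by rewrite /d mulrC [_ * (e / _)]mulrC divfK ?gt_eqF// mulrC.
Qed.

Section Riesz.
Variables (L : F -> R) (C : R).
Hypothesis LD : forall v w, L (v + w) = L v + L w.
Hypothesis LZ : forall t v, L (t%:C *: v) = t * L v.
Hypothesis L_le : forall v, L v <= C * rnorm v.

(* The Riesz vector is the minimiser of [J], obtained as the limit of a
   minimising sequence, Cauchy by the parallelogram identity. *)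
Lemma real_riesz : exists u, forall v, rdot v u = L v.
Proof.
pose J v := rdot v v - 2 * L v.
have Jlb v : - C ^+ 2 <= J v.
  rewrite /J rdot_norm; have := L_le v; have := sqr_ge0 (rnorm v - C).
  have -> : (rnorm v - C) ^+ 2 = rnorm v ^+ 2 - 2 * (C * rnorm v) + C ^+ 2 by ring.
  lra.
pose S := range J.
have Sinf : has_inf S by split; [exists (J 0), 0|exists (- C ^+ 2) => _ [v _ <-]].
have Jinf v : inf S <= J v by apply: ge_inf; [case: Sinf|exists v].
have /choice[v vP] : forall n : nat, exists v, J v < inf S + n.+1%:R^-1.
  move=> n; have n0 : 0 < n.+1%:R^-1 :> R by rewrite invr_gt0.
  by have [_ [v _ <-]] := inf_adherent n0 Sinf; exists v.
have JZ t w z : J (w + t%:C *: z) = J w + (2 * t * (rdot z w - L z) + t ^+ 2 * rdot z z).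
  rewrite /J LD LZ !rdotDl !rdotDr !rdotZl !rdotZr (rdotC w z); ring.
have par w z : rnorm (w - z) ^+ 2 = 2 * J w + 2 * J z - 4 * J ((1 / 2)%:C *: (w + z)).
  rewrite -rdot_norm /J LZ LD !rdotZl !rdotZr !rdotDl !rdotDr !rdotNl !rdotNr (rdotC z w).
  by field.
(* The midpoint of [v n] and [v m] has [J] at least [inf S], while both ends are nearly minimal. *)
have cau n m : rnorm (v n - v m) ^+ 2 <= 2 * n.+1%:R^-1 + 2 * m.+1%:R^-1.
  rewrite par; have := vP n; have := vP m; have := Jinf ((1 / 2)%:C *: (v n + v m)).
  move: (n.+1%:R^-1) (m.+1%:R^-1) (J _) (J _) (J _) (inf S) => ? ? ? ? ? ?; lra.
have [u vu] : exists u : F, v @ \oo --> u.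
  suff vc : cvg (v @ \oo) by exists (lim (v @ \oo)).
  apply: cauchy_cvg; apply: cauchy_exP => e e0.
  have [d d0 ->] : exists2 d : R, 0 < d & e = d%:C.
    have er : e \is Num.real by rewrite gtr0_real.
    by exists (Re e); rewrite ?RRe_real// -ltcR RRe_real.
  pose n := Num.truncn (4 / d ^+ 2).
  have nd : 4 * n.+1%:R^-1 < d ^+ 2.
    by rewrite ltr_pdivrMr// mulrC -ltr_pdivrMr ?exprn_gt0// truncnS_gt.
  exists (v n), n => // m /= nm.
  rewrite -ball_normE/= normE ltcR -(@ltr_pXn2r _ 2)// ?nnegrE ?rnorm_ge0 ?(ltW d0)//.
  apply: le_lt_trans nd; apply: (le_trans (cau n m)).
  have : m.+1%:R^-1 <= n.+1%:R^-1 :> R by rewrite lef_pV2 ?posrE// ler_nat.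
  by move: (_^-1) (_^-1) => *; lra.
exists u => w; apply/eqP; rewrite -subr_eq0; apply/eqP; set b := _ - _.
(* Compare [J (v n + t w)] with [inf S] and let [n] grow; only [rdot w] has to pass to the limit. *)
have quad t : 0 <= 2 * t * b + t ^+ 2 * rdot w w.
  have cv : (fun n => n.+1%:R^-1 + (2 * t * (rdot w (v n) - L w) + t ^+ 2 * rdot w w)) @ \oo -->
    0 + (2 * t * (rdot w u - L w) + t ^+ 2 * rdot w w).
    apply: cvgD; first exact: cvg_harmonic.
    apply: cvgD; last exact: cvg_cst.
    apply: cvgM; first exact: cvg_cst.
    by apply: cvgB; [exact: rdot_cvg|exact: cvg_cst].
  rewrite add0r in cv; apply: ler_cvg_to (cvg_cst 0) cv _; apply: nearW => n.
  have := Jinf (v n + t%:C *: w); rewrite JZ; have := vP n.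
  by move: (_^-1) => *; lra.
apply/eqP/negPn/negP => b0.
have q0 : 0 <= rdot w w by rewrite rdot_norm sqr_ge0.
(* At this [t] the quadratic is negative unless [b = 0]; the [+ 1] keeps the denominator
   positive. *)
have := quad (- b / (rdot w w + 1)).
rewrite leNgt => /negP; apply.
have q1 : 0 < rdot w w + 1 by lra.
have b2 : 0 < b ^+ 2 by rewrite lt_neqAle sqr_ge0 eq_sym sqrf_eq0 b0.
have -> : 2 * (- b / (rdot w w + 1)) * b + (- b / (rdot w w + 1)) ^+ 2 * rdot w w =
  - (b ^+ 2 / (rdot w w + 1) ^+ 2 * (rdot w w + 2)) by field; rewrite gt_eqF.
rewrite oppr_lt0; apply: mulr_gt0; first by apply: divr_gt0 => //; exact: exprn_gt0.
by rewrite ltr_wpDl.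
Qed.
End Riesz.
End HilbertSpace.

Section Operators.
Variables (R : realType) (F : completeNormedModType R[i]).
Variable dot : {dot F for Num.conj}.
Hypothesis hdot : hilbert_dot dot.
Local Notation sp := (sprod dot).
Local Notation BF := (bounded_operator F).
Implicit Types (v w : F).

Lemma complex_eq (x y : R[i]) : Re x = Re y -> Im x = Im y -> x = y.
Proof. by case: x y => [? ?] [? ?] /= -> ->. Qed.

Lemma bounded_operator_ext (S T : BF) : (forall v, S v = T v) -> S = T.
Proof.
case: S => [S HS]; case: T => [T HT] /= ST.
have E : S = T.
  case: S T ST {HS HT} => [S [[SD] [SZ]]] [T [[TD] [TZ]]] /= ST.
  have E : S = T by apply/funext.
  case: _ / E TD TZ {ST} => TD TZ.
  by rewrite (Prop_irrelevance SD TD) (Prop_irrelevance SZ TZ).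
by case: _ / E HT {ST} => HT; congr BoundedOperator; exact: Prop_irrelevance.
Qed.

(** * Operators from bounded sesquilinear forms *)

Section Sesquilinear.
Variables (B : F -> F -> R[i]) (M : R).
Hypothesis BDl : forall v v' w, B (v + v') w = B v w + B v' w.
Hypothesis BZl : forall c v w, B (c *: v) w = conjc c * B v w.
Hypothesis BPr : forall c v w w', B v (c *: w + w') = c * B v w + B v w'.
Hypothesis B_le : forall v w, Re (B v w) <= M * (rnorm v + rnorm w) ^+ 2.

Let BZr c v w : B v (c *: w) = c * B v w.
Proof.
have B0 : B v 0 = 0.
  by have := BPr 1 v 0 0; rewrite scale1r addr0 mul1r => /(canLR (addrK _)); rewrite subrr.
by have := BPr c v w 0; rewrite addr0 B0 addr0.
Qed.

Let rnormZ (t : R) v : 0 <= t -> rnorm (t%:C *: v) = t * rnorm v.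
Proof.
move=> t0; rewrite /rnorm normrZ ger0_norm ?ler0c//.
by rewrite [in LHS](normE v) -rmorphM.
Qed.

Let rnorm_eq0 v : rnorm v = 0 -> v = 0.
Proof. by move=> v0; apply/eqP; rewrite -normr_eq0 normE v0. Qed.

(** By homogeneity, [B_le] is applied to unit vectors, where the squared sum of norms is [4]. *)
Let B_bound v w : Re (B v w) <= (4 * M * rnorm w) * rnorm v.
Proof.
have [/rnorm_eq0 ->|v0] := eqVneq (rnorm v) 0.
  have := BZl 0 0 w; rewrite scale0r conjc0 mul0r => ->.
  by rewrite /rnorm normr0 mulr0.
have [/rnorm_eq0 ->|w0] := eqVneq (rnorm w) 0.
  have := BZr 0 v 0; rewrite scale0r mul0r => ->.
  by rewrite /rnorm normr0 mulr0 mul0r.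
have vp : 0 < rnorm v by rewrite lt_neqAle eq_sym v0 rnorm_ge0.
have wp : 0 < rnorm w by rewrite lt_neqAle eq_sym w0 rnorm_ge0.
have := B_le ((rnorm v)^-1%:C *: v) ((rnorm w)^-1%:C *: w).
rewrite BZl BZr conjc_real !ReZ !rnormZ ?invr_ge0 ?rnorm_ge0// !mulVf//.
rewrite ler_pdivrMl// ler_pdivrMl// => /le_trans; apply.
by rewrite le_eqVlt; apply/orP; left; apply/eqP; ring.
Qed.

(** Riesz represents [Re (B v w)] for each [w], and testing on ['i *: v] recovers the imaginary
    part. The bound on [T w] comes from taking [v = T w]. *)
Lemma sesquilinear_operator : exists T : BF, forall v w, sp v (T w) = B v w.
Proof.
have ex w : exists u, forall v, sp v u = B v w.
  have [] := @real_riesz _ _ _ hdot (fun v => Re (B v w)) (4 * M * rnorm w).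
  - by move=> v v'; rewrite BDl ReD.
  - by move=> t v; rewrite BZl conjc_real ReZ.
  - by move=> v; exact: B_bound.
  move=> u uE; exists u => v; apply: complex_eq; first exact: uE.
  have := uE ('i%C *: v); rewrite /rdot sprodZl BZl.
  by case: (sp v u) (B v w) => [x y] [x' y'] /=; rewrite !(mul0r, sub0r, mulN1r, opprK, mul1r).
have [T TE] := choice ex.
have Tlin : linear T.
  by move=> c w w'; apply: (sprod_eq hdot) => v; rewrite TE sprodDr sprodZr !TE BPr.
have Tbnd w : `|T w| <= (4 * M)%:C * `|w|.
  rewrite !normE -rmorphM lecR.
  have := B_bound (T w) w; rewrite -TE sprod_norm//= => h.
  have [->|t0] := eqVneq (rnorm (T w)) 0.
    (* When [T w = 0] it remains to see that [M * |w|] is nonnegative, which is [B_le] at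
       [v = 0]. *)
    have := B_le 0 w; have := BZl 0 0 w; rewrite scale0r conjc0 mul0r => ->.
    rewrite /rnorm normr0 add0r => h'; have [->|w0] := eqVneq (Re `|w|) 0; first by rewrite mulr0.
    have wp : 0 < Re `|w| by rewrite lt_neqAle eq_sym w0 (rnorm_ge0 w).
    move: h'; rewrite expr2 mulrA pmulr_lge0// => h'.
    by rewrite -mulrA mulr_ge0.
  have tp : 0 < rnorm (T w) by rewrite lt_neqAle eq_sym t0 rnorm_ge0.
  by rewrite -(ler_pM2r tp) -expr2.
pose T' : {linear F -> F} := HB.pack T (GRing.isLinear.Build _ _ _ _ T Tlin).
by exists (@BoundedOperator _ _ T' (ex_intro _ (4 * M) Tbnd)).
Qed.
End Sesquilinear.

(** Reality at [v + w] compares the imaginary parts, reality at [v + 'i *: w] the real parts. *)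
Lemma real_hermitian (T : BF) : (forall v, Im (sp v (T v)) = 0) -> hermitian_operator dot T.
Proof.
move=> Treal v w; rewrite sprodC.
have h1 := Treal (v + w); rewrite linearD sprodDl !sprodDr in h1.
have h2 := Treal (v + 'i%C *: w).
rewrite linearD linearZ/= sprodDl !sprodDr !sprodZl !sprodZr in h2.
move: (Treal v) (Treal w) h1 h2.
case: (sp v (T v)) (sp w (T w)) (sp v (T w)) (sp w (T v)) => [a a'] [b b'] [c c'] [d d'] /= -> ->.
rewrite !(mul0r, sub0r, mulN1r, mulr0, mul1r, addr0, add0r, oppr0, subr0, opprK).
move=> h1 h2; apply: complex_eq => /=; lra.
Qed.

(** The factor [1 / 2] is kept inside the vectors so that the coefficients are exactly
    [1, i, -1, -i], as in [complex_measure_integral]. *)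
Lemma polarization (T : BF) v w :
  sp v (T w) = \sum_(k < 4) 'i%C ^+ k *
    sp ((1 / 2)%:C *: (w + 'i%C ^+ k *: v)) (T ((1 / 2)%:C *: (w + 'i%C ^+ k *: v))).
Proof.
have i2 : 'i%C ^+ 2 = -1 :> R[i] by exact: sqr_i.
have ci : conjc 'i%C = - 'i%C :> R[i] by apply: complex_eq; rewrite /= ?oppr0.
have TD x y : T (x + y) = T x + T y by exact: linearD.
have TZ c x : T (c *: x) = c *: T x by exact: linearZ.
have conjX k : conjc ('i%C ^+ k) = (- 'i%C) ^+ k :> R[i] by rewrite -ci; exact: rmorphXn.
have e k : sp ((1 / 2)%:C *: (w + 'i%C ^+ k *: v)) (T ((1 / 2)%:C *: (w + 'i%C ^+ k *: v))) =
  (1 / 4)%:C * (sp w (T w) + 'i%C ^+ k * sp w (T v) +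
    (- 'i%C) ^+ k * (sp v (T w) + 'i%C ^+ k * sp v (T v))).
  rewrite TZ TD TZ sprodZl sprodZr conjc_real mulrA -rmorphM/=.
  rewrite sprodDl !sprodDr !sprodZl !sprodZr conjX.
  by rewrite mulf_div mulr1 -natrM; congr (_ * _); rewrite mulrDr.
under eq_bigr do rewrite e.
have q4 : (1 / 4)%:C = 4^-1 :> R[i] by rewrite div1r fmorphV/= rmorph_nat.
rewrite !big_ord_recr big_ord0 q4/=.
have i3 : 'i%C ^+ 3 = - 'i%C :> R[i] by rewrite exprS i2 mulrN1.
rewrite expr0 expr1 i2 i3 (expr0 (- 'i%C)) (expr1 (- 'i%C)) sqrrN i2 [(- 'i%C) ^+ 3]exprS sqrrN i2.
move: (sp _ _) (sp _ _) (sp _ _) (sp _ _) => a b c d.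
have ii : 'i%C * 'i%C = -1 :> R[i] by rewrite -expr2.
move: ('i%C : R[i]) ii => I ii.
transitivity (4^-1 * (2 * d + 2 * b + (I * I) * (2 * b - 2 * d))); last by ring.
by rewrite ii; field.
Qed.

End Operators.

(** * From reflection positivity to the measure *)

Lemma Re_sum (R : realType) (I : Type) (r : seq I) (f : I -> R[i]) :
  Re (\sum_(i <- r) f i) = \sum_(i <- r) Re (f i).
Proof. by elim: r => [|i r IH]; rewrite ?big_nil// !big_cons ReD IH. Qed.

Lemma ImD (R : realType) (x y : R[i]) : Im (x + y) = Im x + Im y.
Proof. by case: x y => [? ?] []. Qed.

Lemma Im_sum (R : realType) (I : Type) (r : seq I) (f : I -> R[i]) :
  Im (\sum_(i <- r) f i) = \sum_(i <- r) Im (f i).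
Proof. by elim: r => [|i r IH]; rewrite ?big_nil// !big_cons ImD IH. Qed.

Lemma ReMr (R : realType) (x : R[i]) (t : R) : Re (x * t%:C) = Re x * t.
Proof. by case: x => [a b] /=; rewrite mulr0 subr0. Qed.

Lemma ImMr (R : realType) (x : R[i]) (t : R) : Im (x * t%:C) = Im x * t.
Proof. by case: x => [a b] /=; rewrite mulr0 add0r. Qed.

Lemma sum4_i (R : realType) (x : 'I_4 -> R[i]) :
  \sum_(k < 4) 'i%C ^+ k * x k =
  x 0 + 'i%C * x 1 - x 2%:R - 'i%C * x 3%:R.
Proof.
rewrite !big_ord_recl big_ord0 addr0/= expr0 mul1r expr1 sqr_i.
have -> : 'i%C ^+ 3 = - 'i%C :> R[i] by rewrite exprS sqr_i mulrN1.
rewrite mulN1r mulNr !addrA; congr (x _ + _ * x _ - x _ - _ * x _); exact: val_inj.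
Qed.

Section Forward.
Variables (R : realType) (F : completeNormedModType R[i]).
Variable dot : {dot F for Num.conj}.
Hypothesis hdot : hilbert_dot dot.
Local Notation sp := (sprod dot).
Local Notation BF := (bounded_operator F).
Local Notation halfline := (`[0, +oo[%classic : set R).
Variable phi : R -> BF.
Hypothesis phi_cont : strongly_continuous phi.
Hypothesis phi_rp : reflection_positive dot phi.

Let g (v : F) (s : R) : R := rdot dot v (phi s v).

(** For [s > 0] take the single point [s / 2] in (RP2), for [s = 0] a single point in (RP1);
    evenness covers [s < 0]. *)
Lemma rp_diag_ge0 (v : F) s : 0 <= sp v (phi s v).
Proof.
have [pd1 phiN pd2] := phi_rp.
wlog s0 : s / 0 <= s.
  move=> h; have [|/ltW s0] := leP 0 s; first exact: h.
  by rewrite -(opprK s) phiN; apply: h; rewrite oppr_ge0.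
have [->|sN0] := eqVneq s 0.
  have := pd1 1%N (fun=> 0) (fun=> v) (fun=> I).
  by rewrite !big_ord_recr !big_ord0/= subrr !add0r.
have sp0 : 0 < s by rewrite lt_neqAle eq_sym sN0.
have := pd2 1%N (fun=> s / 2) (fun=> v) (fun=> divr_gt0 sp0 (ltr0Sn _ _)).
by rewrite !big_ord_recr !big_ord0/= !add0r -splitr.
Qed.

Lemma rp_diagE (v : F) s : sp v (phi s v) = (g v s)%:C.
Proof. by rewrite /g /rdot RRe_real// ger0_real// rp_diag_ge0. Qed.

(** (RP1) at the points [0] and [s] with vectors [v] and [- v] reads [2 g 0 - 2 g s >= 0]. *)
Lemma rp_diag_le (v : F) s : `|g v s| <= g v 0.
Proof.
have g0 : 0 <= g v s by rewrite -ler0c -rp_diagE rp_diag_ge0.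
rewrite ger0_norm//; have [pd1 phiN _] := phi_rp.
have := pd1 2%N (fun j => if j == 0 then 0 else s) (fun j => if j == 0 then v else - v) (fun=> I).
rewrite !big_ord_recr !big_ord0/= !add0r oppr0 addr0 subrr phiN.
have spNr x y : sp x (- y) = - sp x y by exact: linearNl.
have spNl x y : sp (- x) y = - sp x y by exact: linearNr.
have phNr t x : phi t (- x) = - phi t x by exact: linearN.
rewrite !phNr !spNl !spNr opprK !rp_diagE lecE/= => /andP[_].
lra.
Qed.

Lemma rp_diag_continuous v : continuous (g v).
Proof. by move=> x; apply: (rdot_cvg hdot); exact: phi_cont. Qed.

Lemma rp_diag_pd v n (s c : 'I_n -> R) : (forall j, 0 < s j) ->
  0 <= \sum_(j < n) \sum_(k < n) c j * c k * g v (s j + s k).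
Proof.
move=> s0; have [_ _ pd2] := phi_rp.
have := pd2 n s (fun j => (c j)%:C *: v) s0.
rewrite lecE => /andP[_]; rewrite Re_sum/=; congr (0 <= _).
apply: eq_bigr => j _; rewrite Re_sum; apply: eq_bigr => k _.
by rewrite linearZ/= sprodZr sprodZl conjc_real rp_diagE mulrA !ReMr/= [c k * _]mulrC.
Qed.

Lemma rp_measures : exists mu : F -> {finite_measure set R -> \bar R},
  forall v s, 0 <= s -> laplace (mu v) s = g v s.
Proof.
suff /choice[mu muE] : forall v, exists m : {finite_measure set R -> \bar R},
    forall s, 0 <= s -> laplace m s = g v s by exists mu.
move=> v.
apply: (@bernstein_pd R (g v) (g v 0)) => [|s|n s c s0].
- exact: rp_diag_continuous.
- exact: rp_diag_le.
- exact: rp_diag_pd.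
Qed.

(** * Polarisation of the spectral measures *)

Section Measures.
Variable mu : F -> {finite_measure set R -> \bar R}.
Hypothesis muE : forall v s, 0 <= s -> laplace (mu v) s = g v s.

(** The Laplace transform determines [mu v] only on the half-line, hence the intersection. *)
Let m (A : set R) v : R := fine (mu v (A `&` halfline)).

(** Transfer principle: a linear relation between the functions [s |-> <u, phi s u>] passes to the
    masses, by uniqueness applied to the real and imaginary parts of the coefficients. *)
Lemma spectral_combination (I : finType) (c : I -> R[i]) (u : I -> F) :
  (forall s, \sum_i c i * sp (u i) (phi s (u i)) = 0) ->
  forall A, measurable A -> \sum_i c i * (m A (u i))%:C = 0.
Proof.
move=> c0 A mA; apply: complex_eq.
  rewrite Re_sum; under eq_bigr do rewrite ReMr.
  apply: (@laplace_combination_eq0 R I (fun i => Re (c i)) (mu \o u)) => // k.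
  have := c0 k.+1%:R; under eq_bigr do rewrite rp_diagE -muE//.
  by move=> /(congr1 (@complex.Re R)); rewrite Re_sum; under eq_bigr do rewrite ReMr.
rewrite Im_sum; under eq_bigr do rewrite ImMr.
apply: (@laplace_combination_eq0 R I (fun i => Im (c i)) (mu \o u)) => // k.
have := c0 k.+1%:R; under eq_bigr do rewrite rp_diagE -muE//.
by move=> /(congr1 (@complex.Im R)); rewrite Im_sum; under eq_bigr do rewrite ImMr.
Qed.

Let pol v w (k : 'I_4) : F := (1 / 2)%:C *: (w + 'i%C ^+ k *: v).

Definition spectral_form (A : set R) v w : R[i] :=
  \sum_(k < 4) 'i%C ^+ k * (m A (pol v w k))%:C.

(** The transfer principle off the diagonal: polarisation replaces each entry by four diagonal
    ones. *)
Lemma spectral_form_combination n (c : 'I_n -> R[i]) (v w : 'I_n -> F) :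
  (forall s, \sum_(j < n) c j * sp (v j) (phi s (w j)) = 0) ->
  forall A, measurable A -> \sum_(j < n) c j * spectral_form A (v j) (w j) = 0.
Proof.
move=> c0 A mA; rewrite /spectral_form; under eq_bigr do rewrite mulr_sumr.
rewrite pair_big/=; under eq_bigr do rewrite mulrA.
apply: (@spectral_combination _ (fun p : 'I_n * 'I_4 => c p.1 * 'i%C ^+ p.2)
  (fun p => pol (v p.1) (w p.1) p.2)) => // s.
transitivity (\sum_(j < n) \sum_(k < 4) c j * ('i%C ^+ k *
    sp (pol (v j) (w j) k) (phi s (pol (v j) (w j) k)))).
  by rewrite pair_big/=; apply: eq_bigr => p _; rewrite mulrA.
by rewrite -[RHS](c0 s); apply: eq_bigr => j _; rewrite -mulr_sumr -polarization.
Qed.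

Lemma spectral_form_diag A v : measurable A -> spectral_form A v v = (m A v)%:C.
Proof.
move=> mA; apply/eqP; rewrite -subr_eq0; apply/eqP.
(* The relation transferred is the polarisation identity at [v, v]: [Some k] indexes its four terms
   and [None] the vector [v] itself. *)
pose c (j : option 'I_4) : R[i] := if j is Some k then 'i%C ^+ k else -1.
pose u (j : option 'I_4) := if j is Some k then pol v v k else v.
have sumo (f : option 'I_4 -> R[i]) : \sum_j f j = \sum_(k < 4) f (Some k) + f None.
  rewrite (bigD1 None)//= addrC; congr (_ + _).
  rewrite (reindex_omap Some id)//=; last by case.
  by apply: eq_bigl => k; rewrite eqxx.
have := @spectral_combination _ c u _ A mA; rewrite sumo/= mulN1r; apply => s.
by rewrite sumo/= -polarization mulN1r subrr.
Qed.

Lemma spectral_mass_ge0 A v : 0 <= m A v.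
Proof. by rewrite fine_ge0. Qed.

Lemma spectral_mass_le A v : measurable A -> m A v <= g v 0.
Proof.
move=> mA; have mD : measurable halfline by exact: measurable_itv.
rewrite -muE// (_ : laplace (mu v) 0 = fine (mu v halfline)).
  apply: fine_le; rewrite ?fin_num_measure//; first exact: measurableI.
  by apply: le_measure; rewrite ?inE//; exact: measurableI.
rewrite /laplace; under eq_Rintegral do rewrite mulr0 expR0.
by rewrite Rintegral_cst// mul1r.
Qed.

(** Each linearity rule for the form is a relation satisfied by [phi s] for every [s], hence
    transferred. For the bound, the real part is a difference of two masses, the first at most
    [g (pol v w 0) 0]. *)
Lemma spectral_operator A : measurable A ->
  exists T : BF, forall v w, sp v (T w) = spectral_form A v w.
Proof.
move=> mA; have [M0 M0P] := bounded_operatorP (phi 0).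
pose M := Num.max M0 0.
have M_ge0 : 0 <= M by rewrite le_max lexx orbT.
have g_le v : g v 0 <= M * rnorm v ^+ 2.
  rewrite /g (le_trans (rdot_le hdot _ _))// expr2 mulrCA ler_wpM2l ?rnorm_ge0//.
  have := M0P v; rewrite !normE -rmorphM lecR => /le_trans; apply.
  by rewrite ler_wpM2r ?rnorm_ge0// le_max lexx.
apply: (@sesquilinear_operator _ _ _ hdot (spectral_form A) M).
- move=> v v' w.
  pose vs : seq F := [:: v + v'; v; v'].
  pose cs : seq R[i] := [:: 1; -1; -1].
  have := @spectral_form_combination 3 (nth 0 cs) (nth 0 vs) (fun=> w) _ A mA.
  rewrite !big_ord_recr big_ord0/= add0r mul1r !mulN1r => H.
  apply/eqP; rewrite -subr_eq0 opprD addrA; apply/eqP; apply: H => s.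
  by rewrite !big_ord_recr big_ord0/= sprodDl; ring.
- move=> c v w.
  pose vs : seq F := [:: c *: v; v].
  pose cs : seq R[i] := [:: 1; - conjc c].
  have := @spectral_form_combination 2 (nth 0 cs) (nth 0 vs) (fun=> w) _ A mA.
  rewrite !big_ord_recr big_ord0/= add0r mul1r mulNr => H.
  apply/eqP; rewrite -subr_eq0; apply/eqP; apply: H => s.
  by rewrite !big_ord_recr big_ord0/= sprodZl; ring.
- move=> c v w w'.
  pose ws : seq F := [:: c *: w + w'; w; w'].
  pose cs : seq R[i] := [:: 1; - c; -1].
  have := @spectral_form_combination 3 (nth 0 cs) (fun=> v) (nth 0 ws) _ A mA.
  rewrite !big_ord_recr big_ord0/= add0r mul1r mulNr mulN1r => H.
  apply/eqP; rewrite -subr_eq0 opprD addrA; apply/eqP; apply: H => s.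
  by rewrite !big_ord_recr big_ord0/= linearP sprodDr sprodZr; ring.
- move=> v w; rewrite /spectral_form sum4_i.
  have -> : Re ((m A (pol v w 0))%:C + 'i%C * (m A (pol v w 1))%:C -
      (m A (pol v w 2%:R))%:C - 'i%C * (m A (pol v w 3%:R))%:C) =
      m A (pol v w 0) - m A (pol v w 2%:R).
    by rewrite /= !(mul0r, mul1r, mulr0, subr0, add0r, addr0, oppr0).
  apply: (@le_trans _ _ (g (pol v w 0) 0)).
    by have := spectral_mass_ge0 A (pol v w 2%:R); have := spectral_mass_le (pol v w 0) mA; lra.
  apply: (le_trans (g_le _)); rewrite ler_wpM2l//.
  rewrite lerXn2r ?nnegrE ?rnorm_ge0 ?addr_ge0 ?rnorm_ge0//.
  rewrite -lecR -normE rmorphD/= -!normE /pol expr0 scale1r normrZ.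
  have h : `|(1 / 2)%:C| <= 1 :> R[i].
    rewrite ger0_norm ?ler0c ?divr_ge0//.
    suff : (1 / 2)%:C <= (1 : R)%:C by [].
    by rewrite lecR ler_pdivrMr// mul1r ler1n.
  apply: (@le_trans _ _ `|w + v|); first by rewrite ler_piMl.
  by rewrite addrC ler_normD.
Qed.

Lemma real_complex_cvg (u : nat -> R) (l : R) : u @ \oo --> l ->
  (fun n => (u n)%:C : R[i]^o) @ \oo --> (l%:C : R[i]^o).
Proof.
move=> ul; apply/cvgrPdist_lt => e e0.
have er : e \is Num.real by rewrite gtr0_real.
have eE : e = (Re e)%:C by rewrite RRe_real.
have e0' : 0 < Re e by rewrite -ltcR -eE.
move/cvgrPdist_lt : ul => /(_ _ e0'); apply: filterS => n h.
by rewrite eE -rmorphB normc_def/= expr0n/= addr0 sqrtr_sqr ltcR.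
Qed.

Theorem rp_hermitian_measure : exists Q : set R -> BF,
  hermitian_measure dot halfline Q /\
  forall x : R,
    weak_integral dot halfline Q (fun lambda => expR (- lambda * `|x|)) (phi x).
Proof.
have /choice[Q QE] : forall A : set R, exists T : BF,
    measurable A -> forall v w, sp v (T w) = spectral_form A v w.
  (* Non-measurable sets receive the arbitrary value [phi 0]. *)
  move=> A; have [mA|nmA] := pselect (measurable A); last by exists (phi 0).
  by have [T TE] := spectral_operator mA; exists T.
have mD : measurable halfline by exact: measurable_itv.
have Q0 A v : measurable A -> 0 <= sp v (Q A v).
  by move=> mA; rewrite QE// spectral_form_diag// ler0c spectral_mass_ge0.
exists Q; split; first split.
- move=> A mA AD; split; last by move=> v; exact: Q0.
  by apply: real_hermitian => v; apply: ger0_Im; exact: Q0.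
- move=> A mA AD tA v w.
  have mU : measurable (\bigcup_n A n) by exact: bigcup_measurable.
  rewrite QE//.
  have -> : (fun n : nat => \sum_(i < n) sp v (Q (A i) w) : R[i]^o) =
      (fun n => \sum_(k < 4) 'i%C ^+ k * ((\sum_(0 <= i < n) m (A i) (pol v w k))%:C : R[i]^o)).
    apply/funext => n; under eq_bigr do rewrite QE// /spectral_form.
    rewrite exchange_big/=; apply: eq_bigr => k _.
    by rewrite rmorph_sum big_mkord mulr_sumr.
  apply: cvg_big => [|k _]; first exact: add_continuous.
  apply: cvgM; first exact: cvg_cst.
  apply: real_complex_cvg; rewrite /m setI_bigcupl.
  apply: fine_measure_cvg; first by move=> i; exact: measurableI.
  exact: trivIset_setIr.
(* The four polarised measures are the required decomposition. *)
- move=> x v w; exists (fun k => mu (pol v w k)); split.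
  + by move=> A mA AD; rewrite QE// /spectral_form /m (setIidl AD).
  + by move=> k; exact: integrable_expRNM.
  + have -> : phi x = phi `|x|.
      have [_ phiN _] := phi_rp; have [x0|x0] := leP 0 x; first by rewrite ger0_norm.
      by rewrite ltr0_norm// phiN.
    rewrite polarization; apply: eq_bigr => k _.
    by rewrite rp_diagE -muE.
Qed.
End Measures.
End Forward.

(** * From the measure to reflection positivity *)

Section Schur.
Variables (R : realType) (F : completeNormedModType R[i]).
Variable dot : {dot F for Num.conj}.
Local Notation sp := (sprod dot).
Local Notation BF := (bounded_operator F).

(** Positivity is tested against a positive operator, the form in which one cell of a Riemann sum
    contributes. *)
Definition schur_kernel n (K : 'I_n -> 'I_n -> R) : Prop :=
  forall (T : BF) (v : 'I_n -> F), positive_hermitian dot T ->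
    0 <= \sum_j \sum_k (K j k)%:C * sp (v j) (T (v k)).

Lemma sprod_suml n (v : 'I_n -> F) w : sp (\sum_j v j) w = \sum_j sp (v j) w.
Proof. by rewrite /sprod linear_sumr. Qed.

Lemma sprod_sumr n (v : 'I_n -> F) w : sp w (\sum_j v j) = \sum_j sp w (v j).
Proof. by rewrite /sprod linear_sumlz. Qed.

Lemma schur_rank1 n (g : 'I_n -> R) : schur_kernel (fun j k => g j * g k).
Proof.
move=> T v [_ Tpos]; have := Tpos (\sum_j (g j)%:C *: v j).
rewrite linear_sum/= sprod_suml; congr (0 <= _).
apply: eq_bigr => j _; rewrite sprod_sumr; apply: eq_bigr => k _.
by rewrite linearZ/= sprodZl sprodZr conjc_real mulrA -rmorphM.
Qed.

Lemma schur_scale n (g : 'I_n -> R) (K : 'I_n -> 'I_n -> R) :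
  schur_kernel K -> schur_kernel (fun j k => g j * g k * K j k).
Proof.
move=> psdK T v Tpos; have := psdK T (fun j => (g j)%:C *: v j) Tpos; congr (0 <= _).
apply: eq_bigr => j _; apply: eq_bigr => k _.
rewrite linearZ/= sprodZl sprodZr conjc_real !rmorphM/=; ring.
Qed.

(* Peel off the least positive value [a j0], a rank one kernel. *)
Lemma schur_min n (a : 'I_n -> R) : (forall j, 0 <= a j) ->
  schur_kernel (fun j k => Num.min (a j) (a k)).
Proof.
(* Induction on the number of positive entries: subtracting the least one from all of them
   annihilates at least one. *)
have [N] := ubnP #|[pred j | (0 < a j)%R]|.
elim: N a => // N IH a supp a0 T v Tpos.
have [j0 aj0|none] := pickP (fun j => 0 < a j); last first.
  rewrite big1// => j _; rewrite big1// => k _.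
  have -> : Num.min (a j) (a k) = 0; last by rewrite mul0r.
  have az i : a i = 0 by apply/eqP; rewrite eq_le a0 andbT leNgt none.
  by rewrite !az minxx.
have [i ai imin] := @arg_minP _ _ _ j0 (fun j => 0 < a j) a aj0.
pose g j : R := if 0 < a j then 1 else 0.
pose a' j := a j - a i * g j.
have a'E j k : Num.min (a j) (a k) = a i * (g j * g k) + Num.min (a' j) (a' k).
  rewrite /a' /g; have [aj|aj] := ltP 0 (a j); have [ak|ak] := ltP 0 (a k).
  - by rewrite !mulr1 -addr_minl addrC subrK.
  - have -> : a k = 0 by apply/eqP; rewrite eq_le ak a0.
    have := imin _ aj; rewrite !mulr1 !mulr0 subr0 add0r => h.
    by rewrite !min_r// ?subr_ge0.
  - have -> : a j = 0 by apply/eqP; rewrite eq_le aj a0.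
    have := imin _ ak; rewrite !(mulr1, mul0r, mulr0, subr0, add0r) => h.
    by rewrite !min_l// ?subr_ge0.
  - by rewrite !mulr0 !subr0 add0r.
have a'0 j : 0 <= a' j.
  rewrite /a' /g; have [aj|aj] := ltP 0 (a j); last by rewrite mulr0 subr0.
  by rewrite mulr1 subr_ge0 imin.
have supp' : (#|[pred j | (0 < a' j)%R]| < N)%N.
  rewrite -ltnS; apply: leq_trans supp; rewrite ltnS; apply: proper_card.
  apply/properP; split.
    apply/fintype.subsetP => j; rewrite !inE /a' /g; case: (ltP 0 (a j)) => //.
    by rewrite mulr0 subr0 => /le_lt_trans h /h; rewrite ltxx.
  by exists i; rewrite !inE// /a' /g ai mulr1 subrr ltxx.
have h1 := IH a' supp' a'0 T v Tpos.
have h2 := schur_rank1 g v Tpos.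
have := addr_ge0 (mulr_ge0 (_ : 0 <= (a i)%:C) h2) h1.
rewrite ler0c => /(_ (a0 i)); congr (0 <= _).
rewrite mulr_sumr -big_split/=; apply: eq_bigr => j _.
rewrite mulr_sumr -big_split/=; apply: eq_bigr => k _.
by rewrite a'E rmorphD rmorphM; ring.
Qed.

Lemma schur_exp_dist n (x : 'I_n -> R) (t : R) : 0 <= t ->
  schur_kernel (fun j k => expR (- t * `|x j - x k|)).
Proof.
move=> t0.
have E j k : expR (- t * `|x j - x k|) = expR (- t * x j) * expR (- t * x k) *
    Num.min (expR (2 * t * x j)) (expR (2 * t * x k)).
  wlog xjk : j k / x j <= x k.
    move=> h; have [|/ltW] := leP (x j) (x k); first exact: h.
    by move=> /h; rewrite distrC minC => ->; congr (_ * _); rewrite mulrC.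
  rewrite min_l; last by rewrite ler_expR ler_wpM2l// mulr_ge0.
  rewrite -!expRD ler0_norm ?subr_le0//; congr expR; ring.
have -> : (fun j k => expR (- t * `|x j - x k|)) = (fun j k => expR (- t * x j) * expR (- t * x k) *
    Num.min (expR (2 * t * x j)) (expR (2 * t * x k))).
  by apply/funext => j; apply/funext => k.
by apply: schur_scale; apply: schur_min => j; exact: expR_ge0.
Qed.

End Schur.

(** * Weak integrals as limits of Riemann sums *)

Section Backward.
Variables (R : realType) (F : completeNormedModType R[i]).
Variable dot : {dot F for Num.conj}.
Hypothesis hdot : hilbert_dot dot.
Local Notation sp := (sprod dot).
Local Notation BF := (bounded_operator F).
Local Notation halfline := (`[0, +oo[%classic : set R).

Lemma riemann_sumB (nu1 nu2 : set R -> R) f n :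
  riemann_sum (fun A => nu1 A - nu2 A) f n = riemann_sum nu1 f n - riemann_sum nu2 f n.
Proof. by rewrite /riemann_sum -sumrB; apply: eq_bigr => i _; rewrite mulrBr. Qed.

Lemma eq_riemann_sum (nu1 nu2 : set R -> R) f n :
  (forall A, measurable A -> A `<=` halfline -> nu1 A = nu2 A) ->
  riemann_sum nu1 f n = riemann_sum nu2 f n.
Proof.
move=> h; apply: eq_bigr => i _; rewrite h//; first exact: measurable_cell.
exact: cell_sub.
Qed.

(** The real part of [nu] is [mu 0 - mu 2] and its imaginary part [mu 1 - mu 3], on subsets of the
    half-line. As the Riemann sums involve only [nu], the integral is independent of the
    decomposition. *)
Lemma complex_measure_integral_cvg (nu : set R -> R[i]) (s : R) (c : R[i]) : 0 <= s ->
  complex_measure_integral halfline nu (fun l => expR (- l * s)) c ->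
  riemann_sum (@complex.Re R \o nu) (fun l => expR (- l * s)) @ \oo --> Re c /\
  riemann_sum (@complex.Im R \o nu) (fun l => expR (- l * s)) @ \oo --> Im c.
Proof.
move=> s0 [mu [nuE _ ->]]; pose f l : R := expR (- l * s).
have cv k : riemann_sum (fun A => fine (mu k A)) f @ \oo --> (\int[mu k]_(x in halfline) f x).
  apply: (@riemann_sum_cvg _ (mu k) _ 1); first exact: continuous_expRNM.
  by move=> x x0; exact: expRNM_le1.
have ReIm (x : 'I_4 -> R) : Re (\sum_(k < 4) 'i%C ^+ k * (x k)%:C) = x 0 - x 2%:R /\
    Im (\sum_(k < 4) 'i%C ^+ k * (x k)%:C) = x 1 - x 3%:R.
  by rewrite sum4_i /= !(mul0r, mul1r, mulr0, subr0, add0r, addr0, oppr0).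
split.
  rewrite (ReIm _).1.
  have -> : riemann_sum (@complex.Re R \o nu) f = (fun n =>
      riemann_sum (fun A => fine (mu 0 A)) f n - riemann_sum (fun A => fine (mu 2%:R A)) f n).
    apply/funext => n; rewrite -riemann_sumB; apply: eq_riemann_sum => A mA AD.
    by rewrite /= nuE// (ReIm _).1.
  by apply: cvgB; exact: cv.
rewrite (ReIm _).2.
have -> : riemann_sum (@complex.Im R \o nu) f = (fun n =>
    riemann_sum (fun A => fine (mu 1 A)) f n - riemann_sum (fun A => fine (mu 3%:R A)) f n).
  apply/funext => n; rewrite -riemann_sumB; apply: eq_riemann_sum => A mA AD.
  by rewrite /= nuE// (ReIm _).2.
by apply: cvgB; exact: cv.
Qed.

Section WithMeasure.
Variables (Q : set R -> BF) (phi : R -> BF).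
Hypothesis Qherm : forall A : set R, measurable A -> A `<=` halfline ->
  positive_hermitian dot (Q A).
Hypothesis phiE : forall x : R,
  weak_integral dot halfline Q (fun lambda => expR (- lambda * `|x|)) (phi x).

(** Both values are limits of the same Riemann sums, as [-x] and [x] have the same absolute
    value. *)
Lemma measure_even x : phi (- x) = phi x.
Proof.
apply: bounded_operator_ext => w; apply: (sprod_eq hdot) => v.
have := phiE (- x) v w; rewrite normrN => /(complex_measure_integral_cvg (normr_ge0 _))[r1 i1].
have /(complex_measure_integral_cvg (normr_ge0 _))[r2 i2] := phiE x v w.
by apply: complex_eq; [apply: (cvg_unique _ r1 r2)|apply: (cvg_unique _ i1 i2)].
Qed.

(** The double sum is a limit of sums over cells, each term being nonnegative by the kernel
    hypothesis applied to the operator [Q (cell N i)]. *)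
Lemma measure_positive_definite n (x : 'I_n -> 'I_n -> R) (v : 'I_n -> F) :
  (forall t, 0 <= t -> schur_kernel dot (fun j k => expR (- t * `|x j k|))) ->
  0 <= \sum_(j < n) \sum_(k < n) sp (v j) (phi (x j k) (v k)).
Proof.
move=> psd.
have cell_ge0 N i : 0 <= \sum_(j < n) \sum_(k < n)
    (expR (- (i%:R / N.+1%:R) * `|x j k|))%:C * sp (v j) (Q (cell N i) (v k)).
  apply: psd; first by rewrite divr_ge0.
  by apply: Qherm; [exact: measurable_cell|exact: cell_sub].
(* The projection [p] is the real or the imaginary part: nonnegativity in [R[i]] asks for a
   nonnegative real part and a zero imaginary part. *)
pose S (p : R[i] -> R) N := \sum_(j < n) \sum_(k < n)
  riemann_sum (fun A => p (sp (v j) (Q A (v k)))) (fun l => expR (- l * `|x j k|)) N.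
have SE (p : R[i] -> R) N : (forall t z, p (t%:C * z) = t * p z) ->
    (forall I (r : seq I) f, p (\sum_(i <- r) f i) = \sum_(i <- r) p (f i)) ->
    S p N = \sum_(i < (N.+1 ^ 2).+1) p (\sum_(j < n) \sum_(k < n)
    (expR (- (i%:R / N.+1%:R) * `|x j k|))%:C * sp (v j) (Q (cell N i) (v k))).
  move=> pZ pS; rewrite /S /riemann_sum.
  under eq_bigr do rewrite exchange_big.
  rewrite exchange_big/=; apply: eq_bigr => i _; rewrite pS; apply: eq_bigr => j _.
  by rewrite pS; apply: eq_bigr => k _; rewrite pZ.
have SRe : S (@complex.Re R) @ \oo --> Re (\sum_(j < n) \sum_(k < n) sp (v j) (phi (x j k) (v k))).
  rewrite Re_sum; apply: cvg_big => [|j _]; first exact: add_continuous.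
  rewrite Re_sum; apply: cvg_big => [|k _]; first exact: add_continuous.
  exact: (complex_measure_integral_cvg (normr_ge0 _) (phiE _ _ _)).1.
have SIm : S (@complex.Im R) @ \oo --> Im (\sum_(j < n) \sum_(k < n) sp (v j) (phi (x j k) (v k))).
  rewrite Im_sum; apply: cvg_big => [|j _]; first exact: add_continuous.
  rewrite Im_sum; apply: cvg_big => [|k _]; first exact: add_continuous.
  exact: (complex_measure_integral_cvg (normr_ge0 _) (phiE _ _ _)).2.
rewrite lecE/=; apply/andP; split.
  apply/eqP; apply: cvgn_eq0 SIm => N; rewrite SE.
  - by apply: big1 => i _; apply: ger0_Im; exact: cell_ge0.
  - by move=> t [a b] /=; rewrite mul0r addr0.
  - by move=> *; exact: Im_sum.
apply: ler_cvg_to (cvg_cst 0) SRe _; apply: nearW => N; rewrite SE.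
- by apply: sumr_ge0 => i _; have := cell_ge0 N i; rewrite lecE => /andP[].
- exact: ReZ.
- by move=> *; exact: Re_sum.
Qed.

Theorem measure_reflection_positive : reflection_positive dot phi.
Proof.
split; last 1 first.
- move=> n s v s0; apply: (measure_positive_definite (x := fun j k => s j + s k)) => t t0.
  (* For positive points the absolute value disappears and the exponential factors into a rank one
     kernel. *)
  have -> : (fun j k : 'I_n => expR (- t * `|s j + s k|)) =
      (fun j k => expR (- t * s j) * expR (- t * s k)).
    apply/funext => j; apply/funext => k.
    rewrite ger0_norm; last by apply: addr_ge0; apply/ltW/s0.
    by rewrite mulrDr expRD.
  exact: schur_rank1.
- move=> n x v _; apply: (measure_positive_definite (x := fun j k => x j - x k)) => t t0.
  exact: schur_exp_dist.
- exact: measure_even.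
Qed.
End WithMeasure.
End Backward.

Unset Implicit Arguments.

Theorem proposition4p3p1 (R : realType) (F : completeNormedModType R[i])
    (dot : {dot F for Num.conj}) (hdot : hilbert_dot dot)
    (phi : R -> bounded_operator F) (hphi : strongly_continuous phi) :
  reflection_positive dot phi <->
  exists Q : set R -> bounded_operator F,
    hermitian_measure dot `[0, +oo[ Q /\
    forall x : R,
      weak_integral dot `[0, +oo[ Q (fun lambda => expR (- lambda * `|x|)) (phi x).
Proof.
split=> [phi_rp|[Q [[Qherm _] phiE]]].
  have [mu muE] := rp_measures hdot hphi phi_rp.
  exact: (@rp_hermitian_measure _ _ _ hdot _ phi_rp mu muE).
exact: (@measure_reflection_positive _ _ _ hdot Q phi Qherm phiE).
Qed.
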